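(* Let $L$ be a CM-field with maximal totally real subfield $L_0$. Suppose that $L_0$ has units of almost independent signs and that the Hasse unit index $Q(L)$ equals $2$. Let $(L,\Phi)$ be a simple CM-type. \begin{enumerate} \item The number of isomorphism classes of principal polarizations on a CM-abelian variety of type $(\mathcal{O}_L,\Phi)$ is at most one. \item Suppose in addition that $L$ has class number $1$. If there exists a principally polarized CM-abelian variety of type $(\mathcal{O}_L,\Phi)$, then it is unique up to isomorphism. \end{enumerate}
   Context: Let $n=[L_0:\mathbb{Q}]$, so $[L:\mathbb{Q}]=2n$; $\mathcal{O}_L$ is the ring of integers of $L$; $\mathcal{U}_L$ and $\mathcal{U}_{L_0}$ denote the unit groups of $\mathcal{O}_L$ and $\mathcal{O}_{L_0}$; $\mu_L$ is the group of roots of unity in $L$. The Hasse unit index is $Q(L)=[\mathcal{U}_L:\mu_L\mathcal{U}_{L_0}]\in\{1,2\}$. $L_0$ has units of almost independent signs if every unit in $\mathcal{U}_{L_0}$ is negative under an even number of real embeddings of $L_0$ and, for every pair of real embeddings, there is a unit that is negative under exactly the two embeddings in that pair. A CM-type $\Phi$ of $L$ is a set of $n$ distinct embeddings $L\hookrightarrow\mathbb{C}$, no two of which are complex conjugate. It is simple if it is not induced from a CM-type of a proper CM-subfield of $L$. A complex abelian variety $A$ of dimension $n$ with $L\subset\mathrm{End}(A)\otimes\mathbb{Q}$ is a CM-abelian variety of type $(\mathcal{O}_L,\Phi)$ if the complex representation of $L$ on $\mathrm{Lie}(A)$ is isomorphic to $\sum_{\phi\in\Phi}\phi$ and $\mathrm{End}(A)\simeq\mathcal{O}_L$.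 Principal polarizations are considered up to isomorphism of principally polarized abelian varieties. *)

(* Defs.v *)
From HB Require Import structures.
From mathcomp Require Import all_boot all_order all_algebra all_field.
From mathcomp Require Import sesquilinear complex.
From mathcomp Require Import boolp classical_sets functions cardinality reals.

Set Implicit Arguments.
Unset Strict Implicit.
Unset Printing Implicit Defensive.

Import Order.TTheory GRing.Theory Num.Theory.

Local Open Scope classical_set_scope.
Local Open Scope card_scope.
Local Open Scope ring_scope.

(* A number field is a [fieldExtType rat]; a subfield [K : {subfield L}] is
   regarded as a number field through the type [subvs_of K], whose inclusion
   in [L] is [vsval].  The complex numbers are [R[i]] with [R : realType]. *)

Definition ring_of_integers (L : fieldExtType rat) : set L :=
  [set x | integralOver (intr : int -> L) x].

Definition units (L : fieldExtType rat) : set L :=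
  [set u | [/\ u != 0, ring_of_integers u & ring_of_integers u^-1]].

Definition roots_of_unity (L : fieldExtType rat) : set L :=
  [set z | exists2 m : nat, (0 < m)%N & z ^+ m = 1].

(* For multiplicative groups [H] contained in [U]: [U : H] = k, i.e. the set
   of cosets uH, for u in U, has k elements. *)
Definition index_eq (L : fieldExtType rat) (U H : set L) (k : nat) : Prop :=
  [set [set u * h | h in H] | u in U] #= `I_k.

Definition hasse_unit_index_eq (L : fieldExtType rat) (L0 : {subfield L})
    (q : nat) : Prop :=
  index_eq (@units L)
    [set z * vsval v | z in @roots_of_unity L & v in @units (subvs_of L0)] q.

Definition fractional_ideal (L : fieldExtType rat) (I : set L) : Prop :=
  [/\ exists2 x, I x & x != 0,
      forall x y, I x -> I y -> I (x + y),
      forall a x, ring_of_integers a -> I x -> I (a * x)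
    & exists d, [/\ d != 0, ring_of_integers d
                  & forall x, I x -> ring_of_integers (d * x)]].

Definition ideal_class (L : fieldExtType rat) (I : set L) : set (set L) :=
  [set J | exists2 x, x != 0 & J = [set x * y | y in I]].

Definition class_number_eq (L : fieldExtType rat) (h : nat) : Prop :=
  [set ideal_class I | I in @fractional_ideal L] #= `I_h.

Definition almost_independent_signs (R : realType) (K : fieldExtType rat) :
    Prop :=
  (forall u : K, units u ->
     exists2 k, ~~ odd k & [set s : {rmorphism K -> R} | s u < 0] #= `I_k) /\
  (forall s t : {rmorphism K -> R}, s <> t ->
     exists2 u : K, units u &
       [set r : {rmorphism K -> R} | r u < 0] = [set s; t]).

Definition totally_real (R : realType) (K : fieldExtType rat) : Prop :=
  forall (f : {rmorphism K -> R[i]}) (x : K), f x \is Num.real.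

Definition totally_imaginary (R : realType) (K : fieldExtType rat) : Prop :=
  forall f : {rmorphism K -> R[i]}, exists x : K, f x \isn't Num.real.

Definition CM_field (R : realType) (L : fieldExtType rat) : Prop :=
  totally_imaginary R L /\
  exists2 K : {subfield L}, totally_real R (subvs_of K) & \dim_K {:L} = 2%N.

Definition maximal_totally_real_subfield (R : realType) (L : fieldExtType rat)
    (L0 : {subfield L}) : Prop :=
  totally_real R (subvs_of L0) /\
  forall K : {subfield L}, totally_real R (subvs_of K) -> (K <= L0)%VS.

Definition CM_type (R : realType) (L : fieldExtType rat)
    (Phi : set {rmorphism L -> R[i]}) : Prop :=
  Phi #= `I_((\dim {:L})./2) /\
  forall f g : {rmorphism L -> R[i]},
    Phi f -> Phi g -> ~ (forall x, g x = Num.conj (f x)).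

Definition induced_CM_type (R : realType) (L : fieldExtType rat)
    (K : {subfield L}) (Psi : set {rmorphism subvs_of K -> R[i]}) :
    set {rmorphism L -> R[i]} :=
  [set f : {rmorphism L -> R[i]} |
     Psi (f \o vsval : {rmorphism subvs_of K -> R[i]})].

Definition simple_CM_type (R : realType) (L : fieldExtType rat)
    (Phi : set {rmorphism L -> R[i]}) : Prop :=
  CM_type Phi /\
  ~ exists (K : {subfield L}) (Psi : set {rmorphism subvs_of K -> R[i]}),
      [/\ (K : {vspace L}) != fullv, CM_field R (subvs_of K), CM_type Psi
        & Phi = induced_CM_type Psi].

(* Complex abelian varieties are handled through their analytic
   uniformization: a complex torus C^g / Lambda that carries a polarization. *)

Definition is_lattice (R : realType) (g : nat) (Lambda : set 'cV[R[i]]_g) :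
    Prop :=
  exists b : 'I_(2 * g) -> 'cV[R[i]]_g,
    (forall c : 'I_(2 * g) -> R,
       \sum_i (c i)%:C%C *: b i = 0 -> forall i, c i = 0) /\
    Lambda = [set \sum_i b i *~ k i | k in [set: 'I_(2 * g) -> int]].

(* A polarization (the first Chern class of an ample line bundle) on
   C^g / Lambda is a positive definite hermitian form H, linear in its first
   argument, whose imaginary part is integral on Lambda. *)
Definition is_polarization (R : realType) (g : nat) (Lambda : set 'cV[R[i]]_g)
    (H : {dot 'cV[R[i]]_g for Num.conj}) : Prop :=
  forall x y, Lambda x -> Lambda y -> complex.Im (H x y) \is a Num.int.

(* The isogeny from A = C^g / Lambda to its dual torus attached to H is
   induced by x |-> Im (H x _); it is an isomorphism iff its kernel, which is
   [dual_lattice Lambda H] / Lambda, is trivial. *)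
Definition dual_lattice (R : realType) (g : nat) (Lambda : set 'cV[R[i]]_g)
    (H : {dot 'cV[R[i]]_g for Num.conj}) : set 'cV[R[i]]_g :=
  [set x | forall y, Lambda y -> complex.Im (H x y) \is a Num.int].

Record abelian_variety (R : realType) (g : nat) := AbelianVariety {
  lattice : set 'cV[R[i]]_g;
  latticeP : is_lattice lattice;
  polarizable : exists H, is_polarization lattice H
}.

Definition principal_polarization (R : realType) (g : nat)
    (A : abelian_variety R g) (H : {dot 'cV[R[i]]_g for Num.conj}) : Prop :=
  is_polarization (lattice A) H /\ dual_lattice (lattice A) H = lattice A.

(* The homomorphisms between two tori are the C-linear maps of the tangent
   spaces that map one lattice into the other. *)
Definition endomorphisms (R : realType) (g : nat) (A : abelian_variety R g) :
    set 'M[R[i]]_g :=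
  [set M | forall x, lattice A x -> lattice A (M *m x)].

Definition rational_endomorphisms (R : realType) (g : nat)
    (A : abelian_variety R g) : set 'M[R[i]]_g :=
  [set M | exists2 m : nat, (0 < m)%N & endomorphisms A (M *+ m)].

Definition polarized_isomorphic (R : realType) (g : nat)
    (A1 : abelian_variety R g) (H1 : {dot 'cV[R[i]]_g for Num.conj})
    (A2 : abelian_variety R g) (H2 : {dot 'cV[R[i]]_g for Num.conj}) : Prop :=
  exists M : 'M[R[i]]_g,
    [/\ M \in unitmx, [set M *m x | x in lattice A1] = lattice A2
      & forall x y, H2 (M *m x) (M *m y) = H1 x y].

Definition isomorphic_subrings (S T : pzRingType) (A : set S) (B : set T) :
    Prop :=
  exists f : S -> T,
    [/\ set_bij A B f, f 1 = 1,
        forall x y, A x -> A y -> f (x + y) = f x + f y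
      & forall x y, A x -> A y -> f (x * y) = f x * f y].

(* Lie A = C^g, so that [iota] is itself the representation of L on Lie A. *)
Definition CM_abelian_variety (R : realType) (L : fieldExtType rat)
    (Phi : set {rmorphism L -> R[i]}) (g : nat) (A : abelian_variety R g) :
    Prop :=
  (exists iota : {rmorphism L -> 'M[R[i]]_g},
     (forall a, rational_endomorphisms A (iota a)) /\
     exists (phi : 'I_g -> {rmorphism L -> R[i]}) (P : 'M[R[i]]_g),
       [/\ set_bij [set: 'I_g] Phi phi, P \in unitmx
         & forall a, iota a = invmx P *m diag_mx (\row_i phi i a) *m P]) /\
  isomorphic_subrings (@ring_of_integers L) (endomorphisms A).

(* Main.v *)
From HB Require Import structures.
Require Import Defs.
From mathcomp Require Import all_boot all_order all_algebra all_field.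
From mathcomp Require Import perm sesquilinear complex.
From mathcomp Require Import boolp classical_sets functions cardinality reals.
From mathcomp Require Import sequences exp.
From mathcomp Require Import zify ring.

(** Write $n = [L_0 : \mathbb{Q}]$ and let $\phi_1, \dots, \phi_n$ be the
    embeddings in $\Phi$. In coordinates that diagonalize $L$, a CM abelian
    variety is $\mathbb{C}^n$ modulo a lattice $\Lambda$ on which an integer
    $a$ acts by the diagonal matrix of the $\phi_i(a)$. The rational span of
    $\Lambda$ is a line over $L$, so everything that preserves $\Lambda$ and
    commutes with $L$ is itself in $L$, and the hypothesis on the endomorphism
    ring says that the multipliers of $\Lambda$ are exactly the integers of $L$
    ([CM_abelian_variety_lattice]).

    A principal polarization $H$ makes $\Lambda$ self-dual, so taking adjoints
    preserves the multipliers of $\Lambda$. Comparing eigenvalues, $H$ is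
    diagonal, $H(x, y) = \sum_i h_i x_i \overline{y_i}$ with $h_i > 0$
    ([principal_polarization_diagonal]). The ratio of two principal
    polarizations on the same lattice is again a multiplier, in both directions:
    it is a totally positive unit $u$ of $L_0$. If $u = v \bar v$ for a unit $v$
    of $L$, then multiplication by $v$ is an isomorphism between the two
    polarized varieties. The theorem thus rests on the equality of the group of
    totally positive units of $L_0$ with the group of norms from $\mathcal{U}_L$
    ([totally_positive_unit_norm]).

    That equality is a count modulo squares of $\mathcal{U}_{L_0}$. By
    Dirichlet's bound, any $n$ units satisfy a multiplicative relation
    ([units_relation]), and if they are all positive at one embedding the
    relation may be taken with an odd exponent ([units_odd_relation]). Hence the
    units that are positive at one chosen embedding have dimension at most
    $n - 1$ modulo squares. Units that are negative exactly at two of the other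
    embeddings account for $n - 2$ dimensions of sign vectors, so the totally
    positive units have at most two classes modulo squares. Norms of units fill
    both: a unit $v$ outside $\mu_L \mathcal{U}_{L_0}$ has a nonsquare norm,
    because if $v \bar v = w^2$ then all absolute values of $v / w$ are one and
    $v / w$ is a root of unity by Kronecker's theorem ([nonsquare_norm]).

    Both Dirichlet's bound and Kronecker's theorem are read off from $\Lambda$
    itself: its discreteness makes integers with bounded conjugates repeat
    ([bounded_integers_repeat]), and the invariance of its covolume gives the
    product formula for units ([unit_prod_norm]).

    For the second assertion, the lattices of two such varieties are given by
    fractional ideals; when the class number is one these differ by a principal
    factor, so a diagonal change of coordinates identifies the two lattices
    ([class_number1_lattices]) and the first argument applies. *)

Set Implicit Arguments.
Unset Strict Implicit.
Unset Printing Implicit Defensive.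

Import Order.TTheory GRing.Theory Num.Theory.

Local Open Scope ring_scope.

(** * Preliminaries *)

Lemma sequence_repeat (T : eqType) (f : nat -> T) (N : nat) :
  ~~ uniq [seq f i | i <- iota 0 N] ->
  exists s t, (s < t)%N /\ f s = f t.
Proof.
move=> /negP fN; apply/not_existsP => nrep; case: fN.
rewrite map_inj_in_uniq ?iota_uniq // => i j _ _ Eij.
case: (ltngtP i j) => // [ltij|ltji]; first by case: (nrep i); exists j.
by case: (nrep j); exists i.
Qed.

Lemma eq_col_mx (T : Type) (m n : nat) (A B : 'M[T]_(m, n)) :
  (forall j, col j A = col j B) -> A = B.
Proof.
move=> eqAB; apply/matrixP => i j.
by have /matrixP/(_ i 0) := eqAB j; rewrite !mxE.
Qed.

Lemma rmorphism_ext (S T : pzRingType) (f g : {rmorphism S -> T}) :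
  f =1 g -> f = g.
Proof.
case: f g => [f [[f1] [f2]]] [g [[g1] [g2]]] /= /funext E; move: f1 f2.
rewrite E => f1 f2.
by rewrite (Prop_irrelevance f1 g1) (Prop_irrelevance f2 g2).
Qed.

(** * Lattices *)

Section Lattices.
Variables (R : realType) (n m : nat).
Local Notation C := R[i].

Definition int_span (B : 'M[C]_(n, m)) : set 'cV[C]_n :=
  [set B *m map_mx intr k | k in [set: 'cV[int]_m]]%classic.

Definition real_free (B : 'M[C]_(n, m)) : Prop :=
  forall c : 'cV[R]_m, B *m map_mx (real_complex R) c = 0 -> c = 0.

Lemma int_spanP (B : 'M[C]_(n, m)) x :
  int_span B x <-> exists k : 'cV[int]_m, x = B *m map_mx intr k.
Proof. by split=> [[k _ <-]|[k ->]]; exists k. Qed.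

Lemma int_span_col (B : 'M[C]_(n, m)) j : int_span B (col j B).
Proof.
apply/int_spanP; exists (delta_mx j 0).
by rewrite map_delta_mx colE.
Qed.

Lemma int_spanD (B : 'M[C]_(n, m)) x y :
  int_span B x -> int_span B y -> int_span B (x + y).
Proof.
move=> /int_spanP[k ->] /int_spanP[l ->]; apply/int_spanP; exists (k + l).
by rewrite map_mxD mulmxDr.
Qed.

Lemma real_free_rat_inj (B : 'M[C]_(n, m)) : real_free B -> forall p,
  injective (fun q : 'M[rat]_(m, p) => B *m map_mx ratr q).
Proof.
move=> Bfree p q r /eqP; rewrite -subr_eq0 -mulmxBr -map_mxB => /eqP E.
apply/subr0_eq/matrixP => i j.
suff E0 : col j (map_mx ratr (q - r)) = 0 :> 'cV[R]_m.
  move/matrixP/(_ i 0): E0; rewrite !mxE => /eqP.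
  by rewrite fmorph_eq0 => /eqP.
apply: Bfree; rewrite map_col -map_mx_comp colE mulmxA -colE.
have eqr : real_complex R \o ratr =1 (ratr : rat -> C).
  by move=> z /=; rewrite fmorph_rat.
by rewrite (eq_map_mx _ eqr) E; apply/matrixP => a b; rewrite !mxE.
Qed.

End Lattices.

Section FullLattices.
Variables (R : realType) (n : nat) (B : 'M[R[i]]_(n, n + n)).
Local Notation C := R[i].
Hypothesis Bfree : real_free B.

(** If a complex vector is killed both by $B$ and by its conjugate, then so are
    its real and imaginary parts, which are real relations between the columns
    of $B$. *)
Lemma period_matrix_unit : col_mx B (map_mx Num.conj B) \in unitmx.
Proof.
rewrite unitmxE unitfE -det_tr; apply/negP => /det0P[v vn0].
move=> /(congr1 trmx); rewrite trmx_mul trmxK trmx0 mul_col_mx.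
move=> /eqP; rewrite col_mx_eq0 => /andP[/eqP Bv /eqP Bcv].
have Bvc : B *m map_mx Num.conj v^T = 0.
  move: Bcv => /(congr1 (map_mx Num.conj)); rewrite map_mxM map_mx0.
  rewrite -map_mx_comp => <-; congr (_ *m _).
  by rewrite map_mx_id // => z /=; rewrite conjCK.
have Re0 : map_mx (@complex.Re R) v^T = 0.
  apply: Bfree.
  have -> : map_mx (real_complex R) (map_mx (@complex.Re R) v^T)
     = 2^-1 *: (v^T + map_mx Num.conj v^T).
    apply/matrixP => i j; rewrite !mxE.
    apply: (mulfI (x := 2)); first by rewrite pnatr_eq0.
    by rewrite mulVKf ?pnatr_eq0 // -addcJ.
  by rewrite -scalemxAr mulmxDr Bv Bvc addr0 scaler0.
have Im0 : map_mx (@complex.Im R) v^T = 0.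
  apply: Bfree.
  have -> : map_mx (real_complex R) (map_mx (@complex.Im R) v^T)
     = (2 * 'i)^-1 *: (v^T - map_mx Num.conj v^T).
    apply/matrixP => i j; rewrite !mxE; apply: (mulfI (x := 2 * 'i)).
      by rewrite mulf_neq0 ?pnatr_eq0 ?neq0Ci.
    by rewrite mulVKf ?mulf_neq0 ?pnatr_eq0 ?neq0Ci // mulrAC -subcJ.
  by rewrite -scalemxAr mulmxBr Bv Bvc subr0 scaler0.
case/negP: vn0; apply/eqP/matrixP => i j.
move/matrixP/(_ j i): Re0; move/matrixP/(_ j i): Im0; rewrite !mxE.
by case: (v i j) => a b /= -> ->.
Qed.

Lemma period_spanning p (M N : 'M[C]_(p, n)) : M *m B = N *m B -> M = N.
Proof.
set W := col_mx B (map_mx Num.conj B) => E.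
have BW : B = row_mx 1%:M 0 *m W by rewrite mul_row_col mul1mx mul0mx addr0.
move: E; rewrite BW !mulmxA => /(congr1 (mulmx^~ (invmx W))).
rewrite !mulmxK ?period_matrix_unit // !mul_mx_row => /eq_row_mx[].
by rewrite !mulmx1.
Qed.

(** Discreteness of a lattice: the integral coordinates of a lattice point are
    bounded in terms of its complex ones, so they repeat along a bounded
    sequence. *)
Lemma bounded_lattice_repeat (x : nat -> 'cV[C]_n) (K : C) :
  (forall t, int_span B (x t)) -> (forall t i, `|x t i 0| <= K) ->
  exists s t, (s < t)%N /\ x s = x t.
Proof.
move=> xB xK; pose W := col_mx B (map_mx Num.conj B).
have [k kE] := boolp.choice (fun t => (int_spanP _ _).1 (xB t)).
have Wk t : map_mx intr (k t) =
    invmx W *m col_mx (x t) (map_mx Num.conj (x t)).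
  rewrite kE map_mxM -map_mx_comp.
  have -> : map_mx (Num.conj \o intr) (k t) =
      map_mx intr (k t) :> 'cV[C]_(n + n).
    by apply: eq_map_mx => z /=; rewrite rmorph_int.
  by rewrite -mul_col_mx mulKmx // period_matrix_unit.
pose S : C := \sum_i \sum_j `|invmx W i j| * K.
have kS t i : `|((k t i 0)%:~R : C)| <= S.
  have -> : (k t i 0)%:~R = (map_mx intr (k t) : 'cV[C]_(n + n)) i 0.
    by rewrite mxE.
  rewrite Wk mxE.
  have K0 : 0 <= K.
    case: (ltnP 0 n) => [n0|]; first exact: le_trans (xK 0 (Ordinal n0)).
    by rewrite leqn0 => /eqP n0; exfalso; case: (i) => /= ?; rewrite n0.
  rewrite (le_trans (ler_norm_sum _ _ _)) // /S [leRHS](bigD1 i) //=.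
  rewrite ler_wpDr ?sumr_ge0 // => [a _|].
    by rewrite sumr_ge0 // => b _; rewrite mulr_ge0.
  apply: ler_sum => j _; rewrite normrM ler_wpM2l //.
  case: (split_ordP j) => l ->; rewrite ?col_mxEu ?col_mxEd //.
  by rewrite mxE norm_conjC.
pose c t i : int := k t i 0.
have [N kN] : exists N : nat, forall t i, (`|c t i| <= N)%N.
  exists (Num.bound (complex.Re S)) => t i.
  have := kS t i; rewrite -intr_norm -abszE -pmulrn -/(c t i).
  rewrite -(rmorph_nat (real_complex R)) lecE /= => /andP[_ leS].
  rewrite -(ler_nat R) (le_trans leS) // ltW // archi_boundP //.
  by rewrite (le_trans _ leS) // ler0n.
(* The shift by N makes the coordinates nonnegative. *)
pose code t := [ffun i => inord (absz (c t i + N%:Z)%R) : 'I_(N + N).+1].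
have [s [t [ltst Est]]] : exists s t, (s < t)%N /\ code s = code t.
  pose M := #|{ffun 'I_(n + n) -> 'I_(N + N).+1}|.
  apply: (@sequence_repeat _ code M.+1).
  apply/negP => /card_uniqP; rewrite size_map size_iota => cardE.
  have := max_card [in [seq code i | i <- iota 0 M.+1]].
  by rewrite cardE ltnn.
exists s, t; split=> //; rewrite !kE; congr (_ *m map_mx _ _).
apply/matrixP => i j; rewrite ord1 -/(c s i) -/(c t i).
have lt_code u : (absz (c u i + N%:Z)%R < (N + N).+1)%N by have := kN u i; lia.
move/ffunP/(_ i): Est; rewrite !ffunE => /(congr1 val) /=.
rewrite !inordK // => Est.
by have := kN s i; have := kN t i; lia.
Qed.

End FullLattices.

(** * Lattices with complex multiplication *)

Section CMLattices.
Variables (R : realType) (L : fieldExtType rat) (n : nat).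
Variable phi : 'I_n -> {rmorphism L -> R[i]}.
Local Notation C := R[i].

Definition cm_mx (a : L) : 'M[C]_n := diag_mx (\row_i phi i a).

Lemma cm_mxE a (x : 'cV[C]_n) i : (cm_mx a *m x) i 0 = phi i a * x i 0.
Proof. by rewrite mul_diag_mx !mxE. Qed.

Lemma cm_mxD a b : cm_mx (a + b) = cm_mx a + cm_mx b.
Proof. by apply/matrixP=> i j; rewrite !mxE rmorphD mulrnDl. Qed.

Lemma cm_mxM a b : cm_mx (a * b) = cm_mx a *m cm_mx b.
Proof.
by apply/matrixP=> i j; rewrite mul_diag_mx !mxE rmorphM mulrnAr.
Qed.

Lemma cm_mx1 : cm_mx 1 = 1%:M.
Proof. by apply/matrixP=> i j; rewrite !mxE rmorph1. Qed.

Lemma cm_mx0 : cm_mx 0 = 0.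
Proof. by apply/matrixP=> i j; rewrite !mxE rmorph0 mul0rn. Qed.

Lemma cm_mxMn a m : cm_mx (a *+ m) = cm_mx a *+ m.
Proof.
by elim: m => [|m IH]; rewrite ?cm_mx0 // !mulrS cm_mxD IH.
Qed.

Lemma cm_mx_rat (q : rat) a : cm_mx (q *: a) = (ratr q) *: cm_mx a.
Proof.
apply/matrixP=> i j; rewrite !mxE -mulr_algl rmorphM.
rewrite -[phi i q%:A]/((phi i \o in_alg L) q).
by rewrite fmorph_eq_rat mulrnAr.
Qed.

Lemma cm_mx_comm a b : cm_mx a *m cm_mx b = cm_mx b *m cm_mx a.
Proof. by rewrite -!cm_mxM mulrC. Qed.

Definition stabilizes m (B : 'M[C]_(n, m)) (M : 'M[C]_n) : Prop :=
  forall x, int_span B x -> int_span B (M *m x).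

Lemma stabilizesP m (B : 'M[C]_(n, m)) M :
  stabilizes B M <-> exists N : 'M[int]_m, M *m B = B *m map_mx intr N.
Proof.
split=> [stM|[N MB] x /int_spanP[k ->]]; last first.
  apply/int_spanP; exists (N *m k).
  by rewrite mulmxA MB -mulmxA -map_mxM.
have /boolp.choice[k kE] j : exists k : 'cV[int]_m,
    M *m col j B = B *m map_mx intr k.
  by apply/int_spanP/stM/int_span_col.
exists (\matrix_(i, j) k j i 0).
apply: eq_col_mx => j; rewrite colE -mulmxA -colE kE colE -mulmxA -colE.
by congr (_ *m _); apply/matrixP => i l; rewrite !mxE ord1.
Qed.

Section Orbit.
Variable (B : 'M[C]_(n, n + n)).
Hypotheses (Bfree : real_free B) (dimL : \dim {:L} = (n + n)%N).
Hypothesis Brat :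
  forall a, exists2 m : nat, (0 < m)%N & stabilizes B (cm_mx a *+ m).

Lemma cm_mx_rational a :
  exists N : 'M[rat]_(n + n), cm_mx a *m B = B *m map_mx ratr N.
Proof.
have [m m0 /stabilizesP[N MB]] := Brat a.
exists (m%:R^-1 *: map_mx intr N); rewrite map_mxZ -scalemxAr -map_mx_comp.
have eqi : ratr \o intr =1 (intr : int -> C) by move=> z /=; rewrite ratr_int.
have -> : cm_mx a = m%:R^-1 *: (cm_mx a *+ m).
  apply/matrixP => i j; rewrite [RHS]mxE mulmxnE -[X in _ * X]mulr_natl.
  rewrite mulKf //.
  by rewrite pnatr_eq0 -lt0n.
by rewrite (eq_map_mx _ eqi) -MB fmorphV rmorph_nat -scalemxAl.
Qed.

Lemma lattice_col_neq0 j : exists i, B i j != 0.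
Proof.
apply/existsP/contraT; rewrite negb_exists => /forallP B0.
have : delta_mx j 0 = 0 :> 'cV[R]_(n + n).
  apply: Bfree; rewrite map_delta_mx -colE; apply/matrixP => i l.
  by rewrite !mxE; have := B0 i; rewrite negbK => /eqP.
by move=> /matrixP/(_ j 0); rewrite !mxE !eqxx => /eqP; rewrite oner_eq0.
Qed.

(** The rational span of the lattice is a vector space over $L$ whose
    dimension over the rationals is that of $L$, hence a line. *)
Lemma cm_orbit j0 (q : 'cV[rat]_(n + n)) :
  exists a, cm_mx a *m col j0 B = B *m map_mx ratr q.
Proof.
have /boolp.choice[g gE] (a : L) : exists r : 'cV[rat]_(n + n),
    cm_mx a *m col j0 B = B *m map_mx ratr r.
  have [N NE] := cm_mx_rational a; exists (col j0 N).
  by rewrite map_col !colE !mulmxA NE.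
have g_lin : linear g.
  move=> c a b; apply: (real_free_rat_inj Bfree).
  rewrite -gE map_mxD map_mxZ mulmxDr -scalemxAr -!gE.
  by rewrite cm_mxD cm_mx_rat mulmxDl -scalemxAl.
pose gL : {linear L -> 'cV[rat]_(n + n)} :=
  HB.pack g (GRing.isLinear.Build _ _ _ _ g g_lin).
have inj_g : lker (linfun gL) = 0%VS.
  apply/eqP; rewrite -subv0; apply/subvP => a; rewrite memv_ker lfunE /=.
  move=> /eqP ga; rewrite memv0; have := gE a; rewrite ga map_mx0 mulmx0.
  have [i Bij] := lattice_col_neq0 j0.
  move=> /matrixP/(_ i 0); rewrite cm_mxE !mxE => /eqP.
  by rewrite mulf_eq0 (negPf Bij) orbF fmorph_eq0.
have /eqP : limg (linfun gL) = fullv.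
  apply/eqP; rewrite eqEdim subvf /= limg_dim_eq ?inj_g ?capv0 //.
  by rewrite dimvf /dim /= dimL muln1.
move=> /eqP im_g; have : q \in limg (linfun gL) by rewrite im_g memvf.
by case/memv_imgP => a _ ->; exists a; rewrite gE lfunE.
Qed.

Lemma cm_orbit_col j0 j : exists a, cm_mx a *m col j0 B = col j B.
Proof.
have [a aE] := cm_orbit j0 (delta_mx j 0).
by exists a; rewrite aE map_delta_mx colE.
Qed.

(** Otherwise the whole lattice would lie in a coordinate hyperplane. *)
Lemma cm_orbit_coord_neq0 j0 i : B i j0 != 0.
Proof.
apply/negP => /eqP B0.
have : delta_mx i i = 0 :> 'M[C]_n.
  apply: (period_spanning Bfree); apply: eq_col_mx => j.
  rewrite mul0mx colE -mulmxA -colE; have [a <-] := cm_orbit_col j0 j.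
  apply/matrixP => r s; rewrite ord1 mxE big1 ?mxE // => l _.
  have [->|nli] := eqVneq l i; last by rewrite mxE (negPf nli) andbF mul0r.
  by rewrite cm_mxE [col j0 B _ _]mxE B0 !mulr0.
by move/matrixP/(_ i i); rewrite !mxE !eqxx => /eqP; rewrite oner_eq0.
Qed.

(** A complex linear map commuting with multiplication by $L$ is determined by
    the image of one lattice vector, and $L$ already attains that image. *)
Lemma cm_centralizer M : (0 < n)%N ->
  stabilizes B M -> (forall a, cm_mx a *m M = M *m cm_mx a) ->
  exists c, M = cm_mx c.
Proof.
move=> n0 /stabilizesP[N MB] commM.
pose j0 : 'I_(n + n) := lshift n (Ordinal n0).
have [c cE] := cm_orbit j0 (map_mx intr (col j0 N)); exists c.
apply: (period_spanning Bfree); apply: eq_col_mx => j.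
rewrite !colE -!mulmxA -!colE; have [a <-] := cm_orbit_col j0 j.
rewrite !mulmxA -commM cm_mx_comm -!mulmxA; congr (_ *m _).
rewrite cE -map_mx_comp [in LHS]colE mulmxA MB -mulmxA -colE -map_col.
by congr (_ *m _); apply: eq_map_mx => z /=; rewrite ratr_int.
Qed.

(** The characteristic polynomial of the integral matrix by which $c$ acts on
    the lattice is a monic integral polynomial that vanishes at $c$. *)
Lemma cm_stabilizer_integral c : (0 < n)%N ->
  stabilizes B (cm_mx c) -> ring_of_integers c.
Proof.
move=> n0 /stabilizesP[N MB]; pose i := Ordinal n0.
exists (char_poly N); first exact: char_poly_monic.
rewrite -(fmorph_root (phi i)) -map_poly_comp.
have eqi : phi i \o intr =1 (intr : int -> C).
  by move=> z /=; rewrite rmorph_int.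
rewrite (eq_map_poly eqi) map_char_poly -eigenvalue_root_char.
apply/eigenvalueP; exists (row i B).
  by rewrite -row_mul -MB mul_diag_mx; apply/rowP => s; rewrite !mxE.
apply/negP => /eqP/rowP Bi0; have /negP := cm_orbit_coord_neq0 (lshift n i) i.
by apply; have := Bi0 (lshift n i); rewrite !mxE => ->.
Qed.

End Orbit.
End CMLattices.

(** * The endomorphism ring of a CM abelian variety *)

Section IntegerRing.
Variable L : fieldExtType rat.
Local Notation OL := (@ring_of_integers L).

Lemma ring_of_integers_int (c : int) : OL c%:~R.
Proof. exact: integral_id. Qed.

Variable h : L -> L.
Hypotheses (hO : forall x, OL x -> OL (h x)) (h1 : h 1 = 1).
Hypothesis hD : forall x y, OL x -> OL y -> h (x + y) = h x + h y.
Hypothesis hM : forall x y, OL x -> OL y -> h (x * y) = h x * h y.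
Hypothesis h_inj : forall x y, OL x -> OL y -> h x = h y -> x = y.

Lemma partial_rmorph_int (c : int) : h c%:~R = c%:~R.
Proof.
have h0 : h 0 = 0.
  apply: (addrI (h 0)); rewrite -hD ?addr0 //; exact: (ring_of_integers_int 0).
have hnat (k : nat) : h k%:R = k%:R.
  elim: k => // k IH; rewrite -natr1 hD ?IH ?h1 //.
    exact: (ring_of_integers_int k).
  exact: (ring_of_integers_int 1).
case: c => k; first exact: hnat.
apply: (addIr (h k.+1%:R)); rewrite -hD //.
- by rewrite hnat NegzE rmorphN /= addNr h0.
- exact: ring_of_integers_int.
- exact: (ring_of_integers_int k.+1).
Qed.

Lemma partial_rmorph_horner (p : {poly int}) x : OL x ->
  h (map_poly intr p).[x] = (map_poly intr p).[h x].
Proof.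
move=> Ox; suff [] : OL (map_poly intr p).[x] /\
  h (map_poly intr p).[x] = (map_poly intr p).[h x] by [].
elim/poly_ind: p => [|p c [Op hp]].
  rewrite rmorph0 !horner0; split; first exact: (ring_of_integers_int 0).
  exact: (partial_rmorph_int 0).
rewrite rmorphD rmorphM /= map_polyX map_polyC /= !hornerE.
have Opx : OL ((map_poly intr p).[x] * x) by exact: integral_mul.
split; first by apply: integral_add => //; exact: ring_of_integers_int.
by rewrite hD ?hM ?hp ?partial_rmorph_int //; exact: ring_of_integers_int.
Qed.

(** An injective ring endomorphism of the integers permutes the finitely many
    roots of each monic integral polynomial, so it misses no integer. *)
Lemma ring_of_integers_endo_surj b : OL b -> exists2 a, OL a & h a = b.
Proof.
move=> Ob; have [p p_mon pb] := Ob.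
have Oi i : OL (iter i h b) by elim: i => //= i IH; exact: hO.
have rooti i : root (map_poly intr p) (iter i h b).
  elim: i => //= i /eqP IH; apply/eqP.
  rewrite -partial_rmorph_horner // IH; exact: (partial_rmorph_int 0).
have p0 : map_poly intr p != 0 :> {poly L}.
  by rewrite monic_neq0 // monic_map.
have [s [t [lt_st Est]]] : exists s t, (s < t)%N /\ iter s h b = iter t h b.
  apply: (@sequence_repeat _ _ (size (map_poly intr p : {poly L}))).
  apply/negP => uniq_it; have := max_poly_roots p0 _ uniq_it.
  rewrite size_map size_iota ltnn => big.
  suff : false by []; apply: big.
  by apply/allP => x /mapP[i _ ->]; exact: rooti.
exists (iter (t - s).-1 h b); first exact: Oi.
have Est' : iter s h b = iter s h (iter (t - s) h b).
  by rewrite -iterD subnKC // ltnW.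
have -> : h (iter (t - s).-1 h b) = iter (t - s) h b.
  by rewrite -iterS prednK // subn_gt0.
have O_ts := Oi (t - s)%N.
elim: s b (iter _ _ _) Ob O_ts Est' {Est lt_st Oi rooti pb} => //.
move=> s IH c d Oc Od; rewrite !iterSr => E.
by apply: h_inj => //; apply: IH (hO Oc) (hO Od) E.
Qed.

End IntegerRing.

Lemma lattice_basis (R : realType) (g : nat) (Lambda : set 'cV[R[i]]_g) :
  is_lattice Lambda -> exists2 B : 'M[R[i]]_(g, g + g),
    real_free B & Lambda = int_span B.
Proof.
rewrite /is_lattice mul2n -addnn => -[b [b_free ->]].
pose B := \matrix_(i, j) b j i 0 : 'M[R[i]]_(g, g + g).
have BE (c : 'cV[R[i]]_(g + g)) : B *m c = \sum_j c j 0 *: b j.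
  apply/matrixP => i l; rewrite ord1 !mxE summxE; apply: eq_bigr => j _.
  by rewrite !mxE mulrC.
exists B.
  move=> c; rewrite BE => Bc; apply/matrixP => i l; rewrite ord1 !mxE.
  apply: (b_free (fun i => c i 0)); rewrite -[RHS]Bc.
  by apply: eq_bigr => j _; rewrite mxE.
have sumE (k : 'cV[int]_(g + g)) :
    B *m map_mx intr k = \sum_j b j *~ k j 0.
  by rewrite BE; apply: eq_bigr => j _; rewrite mxE scaler_int.
apply/seteqP; split=> x /=.
  case=> k _ <-; apply/int_spanP; exists (\col_j k j).
  by rewrite sumE; apply: eq_bigr => j _; rewrite mxE.
by move=> /int_spanP[k ->]; exists (fun j => k j 0); rewrite ?sumE.
Qed.

Section EndomorphismRing.
Variables (R : realType) (L : fieldExtType rat) (n : nat).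
Variable phi : 'I_n -> {rmorphism L -> R[i]}.
Local Notation C := R[i].
Local Notation OL := (@ring_of_integers L).
Local Notation cm_mx := (cm_mx phi).

Hypotheses (n_gt0 : (0 < n)%N) (dimL : \dim {:L} = (n + n)%N).

Lemma cm_mx_inj : injective cm_mx.
Proof.
move=> a b /matrixP/(_ (Ordinal n_gt0) (Ordinal n_gt0)).
by rewrite !mxE eqxx; apply: fmorph_inj.
Qed.

(** A lattice whose ring of multipliers, among all complex matrices, is the ring
    of integers of $L$ acting through $\phi$. *)
Record CM_lattice (B : 'M[C]_(n, n + n)) : Prop := {
  cm_free : real_free B;
  cm_rational : forall a, exists2 m, (0 < m)%N & stabilizes B (cm_mx a *+ m);
  cm_multiplier : forall M, stabilizes B M <-> exists2 a, OL a & M = cm_mx a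
}.

Lemma cm_integral_multiple (B : 'M[C]_(n, n + n)) a : CM_lattice B ->
  exists2 m : nat, (0 < m)%N & OL (a *+ m).
Proof.
move=> cmB; have [m m_gt0] := cm_rational cmB a; rewrite -cm_mxMn.
by move=> /(cm_multiplier cmB)[c Oc /cm_mx_inj E]; exists m; rewrite ?E.
Qed.

(** An abstract ring isomorphism suffices: commutativity puts the stabilizer
    inside the image of $L$, integrality inside that of the integers, and the
    isomorphism then becomes an injective endomorphism of the integers. *)
Lemma CM_lattice_of_isomorphism (B : 'M[C]_(n, n + n)) : real_free B ->
  (forall a, exists2 m, (0 < m)%N & stabilizes B (cm_mx a *+ m)) ->
  isomorphic_subrings OL (stabilizes B) -> CM_lattice B.
Proof.
move=> Bfree Brat [f [[f_fun f_inj f_surj] f1 fD fM]].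
have f_im M : stabilizes B M -> exists2 a, OL a & f a = M.
  by move=> /f_surj[a Oa <-]; exists a.
have stab_comm M N : stabilizes B M -> stabilizes B N -> M *m N = N *m M.
  move=> /f_im[a Oa <-] /f_im[b Ob <-].
  by have := fM a b Oa Ob; rewrite mulrC fM.
have stab_cm M : stabilizes B M -> exists2 c, OL c & M = cm_mx c.
  move=> stM; have [|c Mc] := cm_centralizer Bfree dimL Brat n_gt0 stM.
    move=> a; have [m m0 /stab_comm/(_ stM) E] := Brat a.
    have m0C : m%:R != 0 :> C by rewrite pnatr_eq0 -lt0n.
    apply: (scalerI m0C); rewrite scalemxAl scalemxAr.
    by rewrite !scaler_nat.
  exists c => //; apply: (cm_stabilizer_integral Bfree dimL Brat n_gt0).
  by rewrite -Mc.
have /boolp.choice[h hP] x : exists c, OL x -> OL c /\ f x = cm_mx c.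
  have [Ox|nOx] := pselect (OL x); last by exists 0.
  by have [c Oc fc] := stab_cm _ (f_fun x Ox); exists c.
have hO x : OL x -> OL (h x) by move=> /hP[].
have hE x : OL x -> f x = cm_mx (h x) by move=> /hP[].
have O1 : OL 1 := ring_of_integers_int L 1.
split=> // M; split; first exact: stab_cm.
case=> a Oa ->.
have [||||b Ob <-] := @ring_of_integers_endo_surj L h hO _ _ _ _ a Oa.
- by apply: cm_mx_inj; rewrite -hE // f1 cm_mx1.
- move=> x y Ox Oy; apply: cm_mx_inj.
  by rewrite cm_mxD -!hE ?fD //; exact: integral_add.
- move=> x y Ox Oy; apply: cm_mx_inj.
  by rewrite cm_mxM -!hE ?fM //; exact: integral_mul.
- by move=> x y Ox Oy Exy; apply: f_inj; rewrite ?inE // !hE // Exy.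
by rewrite -hE //; exact: f_fun.
Qed.

(** The order in which the CM type is listed is left to the caller, so that two
    varieties can be compared in matching coordinates. *)
Lemma CM_abelian_variety_lattice (Phi : set {rmorphism L -> C})
    (A : abelian_variety R n) :
  set_bij [set: 'I_n] Phi phi -> CM_abelian_variety Phi A ->
  exists (P : 'M[C]_n) (B : 'M[C]_(n, n + n)), [/\ P \in unitmx, CM_lattice B
    & forall x, lattice A x <-> int_span B (P *m x)].
Proof.
move=> [phi_fun phi_inj _].
move=> [[iota [iota_rat [phi0 [P0 [[_ _ phi0_surj] P0u iotaE]]]]] endA].
have /boolp.choice[s sE] i : exists j, phi0 j = phi i.
  by have [j _ ji] := phi0_surj _ (phi_fun i I); exists j.
have s_inj : injective s.
  by move=> i j sij; apply: phi_inj; rewrite ?inE // -!sE sij.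
pose P := row_perm (perm s_inj) P0.
have Pu : P \in unitmx by rewrite /P row_permE unitmx_mul unitmx_perm.
have Pcm a : cm_mx a *m P = P *m iota a.
  apply/row_matrixP => i; rewrite mul_diag_mx [RHS]row_mul.
  have -> : row i P = row (s i) P0 by apply/rowP => j; rewrite !mxE permE.
  rewrite -row_mul iotaE !mulmxA mulmxV // mul1mx mul_diag_mx.
  by apply/rowP => j; rewrite !mxE permE sE.
have [B0 B0_free latE] := lattice_basis (latticeP A).
pose B := P *m B0.
have latB x : lattice A x <-> int_span B (P *m x).
  rewrite latE; split=> /int_spanP[k xE]; apply/int_spanP; exists k.
    by rewrite xE mulmxA.
  by rewrite -(mulKmx Pu x) xE /B -mulmxA mulKmx.
have stabB M : endomorphisms A M <-> stabilizes B (P *m M *m invmx P).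
  split=> [EM x|sM x].
    rewrite -[x](mulKVmx Pu) => /latB/EM/latB.
    by rewrite -!mulmxA !mulmxA mulmxKV.
  by move=> /latB/sM; rewrite !mulmxA mulmxKV // -!mulmxA => /latB.
have B_free : real_free B.
  move=> c; rewrite /B -mulmxA => Bc; apply: B0_free.
  by rewrite -(mulKmx Pu (B0 *m _)) Bc mulmx0.
exists P, B; split=> //; apply: CM_lattice_of_isomorphism => //.
  move=> a; have [m m0 /stabB b] := iota_rat a; exists m => //.
  by move: b; rewrite -rmorphMn /= -Pcm mulmxK // cm_mxMn.
have [f [[f_fun f_inj f_surj] f1 fD fM]] := endA.
exists (fun x => P *m f x *m invmx P); split.
- split.
  + by move=> x Ox; apply/stabB; exact: f_fun.
  + move=> x y Ox Oy E; apply: f_inj => //.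
    by rewrite -(mulKmx Pu (f x)) -[P *m f x](mulmxKV Pu) E mulmxKV // mulKmx.
  + move=> M stM; have [|x Ox fx] := f_surj (invmx P *m M *m P).
      by apply/stabB; rewrite !mulmxA mulmxV // mul1mx mulmxK.
    by exists x => //; rewrite fx !mulmxA mulmxV // mul1mx mulmxK.
- by rewrite f1 mulmx1 mulmxV.
- by move=> x y Ox Oy; rewrite fD // mulmxDr mulmxDl.
- move=> x y Ox Oy; rewrite fM // -mulmxE.
  by rewrite !mulmxA mulmxKV.
Qed.

End EndomorphismRing.

(** * Principal polarizations are diagonal *)

Section Polarizations.
Variables (R : realType) (n : nat).
Local Notation C := R[i].

Lemma Im_conj_int (z : C) :
  (complex.Im z^* \is a Num.int) = (complex.Im z \is a Num.int).
Proof. by case: z => a b /=; rewrite rpredN. Qed.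

Definition diag_form (h : 'I_n -> C) (x y : 'cV[C]_n) : C :=
  \sum_i h i * x i 0 * (y i 0)^*.

(** Principality of the polarization defined by [diag_form h]. *)
Definition self_dual (B : 'M[C]_(n, n + n)) (h : 'I_n -> C) : Prop :=
  forall x, int_span B x <->
    forall y, int_span B y -> complex.Im (diag_form h x y) \is a Num.int.

Variable H : {dot 'cV[C]_n for Num.conj}.

Lemma dot_conj x y : H x y = (H y x)^*.
Proof. by rewrite hermC expr0 mul1r. Qed.

Definition gram (P : 'M[C]_n) : 'M[C]_n :=
  \matrix_(i, j) H (invmx P *m delta_mx i 0) (invmx P *m delta_mx j 0).

Lemma dot_gram (P : 'M[C]_n) x y : P \in unitmx ->
  H x y = ((P *m x)^T *m gram P *m map_mx Num.conj (P *m y)) 0 0.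
Proof.
move=> Pu; have xE (z : 'cV[C]_n) :
    z = \sum_i (P *m z) i 0 *: (invmx P *m delta_mx i 0).
  rewrite -[LHS](mulKmx Pu); move: (P *m z) => w.
  rewrite {1}(matrix_sum_delta w) mulmx_sumr.
  by apply: eq_bigr => i _; rewrite big_ord1 scalemxAr.
rewrite {1}(xE x) linear_sumlz mxE /=.
under eq_bigr => i _ do rewrite linearZl_LR {1}(xE y) linear_sumr mulr_sumr.
rewrite exchange_big; apply: eq_bigr => j _ /=; rewrite !mxE mulr_suml.
apply: eq_bigr => i _; rewrite linearZr_LR /= !mxE.
by rewrite -mulrA; congr (_ * _); rewrite mulrC.
Qed.

Lemma gram_unit P : P \in unitmx -> gram P \in unitmx.
Proof.
move=> Pu; rewrite unitmxE unitfE; apply/negP => /det0P[v v0 vG].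
have : 0 < H (invmx P *m v^T) (invmx P *m v^T).
  rewrite neq0_dnorm_gt0 //; apply: contraNneq v0 => Pv.
  by rewrite -trmx_eq0 -(mulKVmx Pu v^T) Pv mulmx0.
by rewrite (dot_gram _ _ Pu) mulKVmx // trmxK vG mul0mx mxE ltxx.
Qed.

Variables (L : fieldExtType rat) (phi : 'I_n -> {rmorphism L -> C}).
Hypothesis phi_inj : injective phi.

(** Since $H$ identifies the lattice with its own dual, the adjoint of an
    endomorphism is again an endomorphism (the Rosati involution); comparing
    eigenvalues on the diagonal shows that it is complex conjugation, and off
    the diagonal that distinct eigenlines of $L$ are orthogonal. *)
Lemma principal_polarization_diagonal (A : abelian_variety R n)
    (P : 'M[C]_n) (B : 'M[C]_(n, n + n)) :
  P \in unitmx -> CM_lattice phi B ->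
  (forall x, lattice A x <-> int_span B (P *m x)) ->
  principal_polarization A H ->
  exists h : 'I_n -> C, [/\ forall i, 0 < h i, self_dual B h
    & forall x y, H x y = diag_form h (P *m x) (P *m y)].
Proof.
move=> Pu cmB latB [_ H_dual]; have Bmul := cm_multiplier cmB.
pose G := gram P; have Gu : G \in unitmx by exact: gram_unit.
pose K x y := H (invmx P *m x) (invmx P *m y).
have KE x y : K x y = (x^T *m G *m map_mx Num.conj y) 0 0.
  by rewrite /K (dot_gram _ _ Pu) !mulKVmx.
have dualK x : int_span B x <->
    forall y, int_span B y -> complex.Im (K x y) \is a Num.int.
  rewrite -{1}(mulKVmx Pu x) -latB -H_dual; split=> xd y By.
    by apply: xd; apply/latB; rewrite mulKVmx.
  by move/latB: By => /xd; rewrite /K mulKmx.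
have adj a x y : K (cm_mx phi a *m x) y =
    K x (map_mx Num.conj (invmx G *m cm_mx phi a *m G) *m y).
  rewrite !KE trmx_mul tr_diag_mx map_mxM -map_mx_comp.
  rewrite [map_mx (_ \o _) _]map_mx_id => [|z /=]; last exact: conjCK.
  by rewrite !mulmxA mulmxK // -/(cm_mx phi a).
have rosati a : ring_of_integers a -> exists a', forall i j,
    G i j * (phi j a')^* = phi i a * G i j.
  move=> Oa; have stab_a : stabilizes B (cm_mx phi a) by apply/Bmul; exists a.
  have [|a' _ a'E] := (Bmul (map_mx Num.conj (invmx G *m cm_mx phi a *m G))).1.
    move=> x Bx; apply/dualK => y By.
    rewrite /K dot_conj -/(K _ _) -adj Im_conj_int.
    by rewrite /K dot_conj Im_conj_int; apply: (dualK _).1 => //; exact: stab_a.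
  exists a' => i j.
  have : G *m map_mx Num.conj (cm_mx phi a') = cm_mx phi a *m G.
    rewrite -a'E -map_mx_comp map_mx_id => [|z /=]; last exact: conjCK.
    by rewrite !mulmxA mulmxV // mul1mx.
  rewrite map_diag_mx mul_diag_mx mul_mx_diag => /matrixP/(_ i j).
  by rewrite !mxE.
have G_pos i : 0 < G i i.
  rewrite mxE neq0_dnorm_gt0 //; apply/negP => /eqP E.
  have /matrixP/(_ i 0) : delta_mx i 0 = 0 :> 'cV[C]_n.
    by rewrite -(mulKVmx Pu (delta_mx _ _)) E mulmx0.
  by rewrite !mxE !eqxx => /eqP; rewrite oner_eq0.
have G_diag i j : i != j -> G i j = 0.
  move=> /eqP nij; apply/eqP/contraT => Gij; case: nij; apply: phi_inj.
  apply: rmorphism_ext => a.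
  have n_gt0 : (0 < n)%N := leq_ltn_trans (leq0n i) (ltn_ord i).
  have [m m0 /rosati[c' c'E]] := cm_integral_multiple n_gt0 a cmB.
  apply/eqP; rewrite -(eqr_pMn2r m0) -!rmorphMn; apply/eqP.
  apply: (mulIf Gij); rewrite -c'E mulrC; congr (_ * _).
  by apply: (mulfI (lt0r_neq0 (G_pos j))); rewrite c'E mulrC.
exists (fun i => G i i).
have HE x y : H x y = diag_form (fun i => G i i) (P *m x) (P *m y).
  rewrite (dot_gram _ _ Pu) mxE; apply: eq_bigr => i _.
  rewrite !mxE (bigD1 i) //= big1 ?addr0 => [|j nji].
    by rewrite !mxE [_ * H _ _]mulrC.
  by rewrite G_diag ?mulr0.
split=> // x; rewrite dualK.
have KD y : K x y = diag_form (fun i => G i i) x y.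
  by rewrite /K HE !mulKVmx.
by split=> xd y /xd; rewrite KD.
Qed.

End Polarizations.

(** * Multiplicative relations between units *)

Section Units.
Variable L : fieldExtType rat.
Local Notation OL := (@ring_of_integers L).
Local Notation UL := (@units L).

Lemma unitsM x y : UL x -> UL y -> UL (x * y).
Proof.
move=> [x0 Ox Ox'] [y0 Oy Oy']; split; first by rewrite mulf_neq0.
  exact: integral_mul.
by rewrite invfM; exact: integral_mul.
Qed.

Lemma unitsV x : UL x -> UL x^-1.
Proof. by move=> [x0 Ox Ox']; split; rewrite ?invr_eq0 ?invrK. Qed.

Lemma units1 : UL 1.
Proof.
by split; rewrite ?oner_neq0 ?invr1 //; exact: (ring_of_integers_int L 1).
Qed.

Lemma unitsX x (k : int) : UL x -> UL (x ^ k).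
Proof.
move=> Ux; have Ux_nat (m : nat) : UL (x ^+ m).
  by elim: m => [|m IH]; [exact: units1 | rewrite exprS; exact: unitsM].
by case: k => m; rewrite ?NegzE ?exprnN -?exprnP; [|apply: unitsV].
Qed.

Lemma units_prod (I : finType) (w : I -> L) (k : I -> int) :
  (forall i, UL (w i)) -> UL (\prod_i w i ^ k i).
Proof.
move=> Uw; elim/big_ind: _ => [||i _]; [exact: units1|exact: unitsM|].
exact: unitsX.
Qed.

End Units.

Section Dirichlet.
Variables (R : realType) (L : fieldExtType rat) (n : nat).
Variable phi : 'I_n -> {rmorphism L -> R[i]}.
Local Notation C := R[i].
Local Notation OL := (@ring_of_integers L).
Local Notation UL := (@units L).
Hypothesis n_gt0 : (0 < n)%N.
Hypothesis dimL : \dim {:L} = (n + n)%N.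
Variable B : 'M[C]_(n, n + n).
Hypothesis cmB : CM_lattice phi B.

Let j0 : 'I_(n + n) := lshift n (Ordinal n_gt0).

Lemma integers_stabilize a : OL a -> stabilizes B (cm_mx phi a).
Proof. by move=> Oa; apply/(cm_multiplier cmB); exists a. Qed.

(** Multiplying a fixed lattice vector by integers with bounded conjugates
    gives a bounded sequence of lattice vectors. *)
Lemma bounded_integers_repeat (x : nat -> L) (K : C) :
  (forall t, OL (x t)) -> (forall t i, `|phi i (x t)| <= K) ->
  exists s t, (s < t)%N /\ x s = x t.
Proof.
move=> Ox xK.
have K0 : 0 <= K by apply: le_trans (xK 0 (Ordinal n_gt0)).
pose y t := cm_mx phi (x t) *m col j0 B.
have [||s [t [lt_st Est]]] :=
    @bounded_lattice_repeat R n B (cm_free cmB) y (K * \sum_i `|B i j0|).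
- by move=> t; apply: integers_stabilize => //; exact: int_span_col.
- move=> t i; rewrite cm_mxE normrM ler_pM // mxE (bigD1 i) //= lerDl.
  by rewrite sumr_ge0.
exists s, t; split=> //; apply: (cm_mx_inj n_gt0 (phi := phi)).
apply/matrixP => i j; rewrite !mxE; congr (_ *+ _).
move/matrixP/(_ i 0): Est; rewrite !cm_mxE mxE; apply: mulIf.
exact: (cm_orbit_coord_neq0 (cm_free cmB) dimL (cm_rational cmB)).
Qed.

(** The matrix of multiplication by $a$ on a basis of the lattice is integral,
    and over the complex numbers it is similar to the diagonal matrix of all
    conjugates of $a$. *)
Lemma prod_norm_sqr_int a : OL a ->
  exists d : int, (\prod_i `|phi i a|) ^+ 2 = d%:~R.
Proof.
move=> Oa; have /stabilizesP[N NE] := integers_stabilize Oa.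
exists (\det N); rewrite -(det_map_mx intr).
set W := col_mx B (map_mx Num.conj B).
have Wu : W \in unitmx := period_matrix_unit (cm_free cmB).
have : block_mx (cm_mx phi a) 0 0 (map_mx Num.conj (cm_mx phi a)) *m W
    = W *m map_mx intr N.
  rewrite mul_block_col !mul0mx addr0 add0r -map_mxM NE mul_col_mx map_mxM.
  congr (col_mx _ (_ *m _)); rewrite -map_mx_comp.
  by apply: eq_map_mx => z /=; rewrite rmorph_int.
move=> /(congr1 determinant); rewrite !det_mulmx mulrC.
have detW : \det W != 0 by rewrite -unitfE -unitmxE.
move=> /(mulfI detW) <-; rewrite det_ublock map_diag_mx !det_diag.
rewrite expr2 -!big_split; apply: eq_bigr => i _ /=.
by rewrite !mxE -normCK expr2.
Qed.

(** Multiplication by a unit and by its inverse both scale the covolume of the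
    lattice by a positive integer, and these integers are inverse to each
    other. *)
Lemma unit_prod_norm u : UL u -> \prod_i `|phi i u| = 1.
Proof.
move=> [u0 Ou Ou'].
have ge1 a : a != 0 -> OL a -> 1 <= (\prod_i `|phi i a|) ^+ 2.
  move=> a0 Oa; have [d dE] := prod_norm_sqr_int Oa; rewrite dE ler1z -gtz0_ge1.
  rewrite -(ltr0z C) -dE exprn_gt0 // prodr_gt0 // => i _.
  by rewrite normr_gt0 fmorph_eq0.
have prod_ge0 a : 0 <= \prod_i `|phi i a| by apply: prodr_ge0.
apply/eqP; rewrite -(@pexpr_eq1 _ _ 2) // eq_le ge1 // andbT.
have u'0 : u^-1 != 0 by rewrite invr_eq0.
have := ge1 _ u'0 Ou'.
have -> : \prod_i `|phi i u^-1| = (\prod_i `|phi i u|)^-1.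
  by rewrite -prodfV; apply: eq_bigr => i _; rewrite fmorphV normfV.
rewrite exprVn invf_ge1 //.
by rewrite exprn_gt0 // prodr_gt0 // => i _; rewrite normr_gt0 fmorph_eq0.
Qed.

(* The absolute values as elements of R, where logarithms are available. *)
Let nrm (i : 'I_n) (x : L) : R := Normc.normc (phi i x).

Let nrm_gt0 i x : x != 0 -> 0 < nrm i x.
Proof.
move=> x0; have : 0 < `|phi i x| by rewrite normr_gt0 fmorph_eq0.
by rewrite -[`|phi i x|]/((nrm i x)%:C%C) ltcR.
Qed.

Lemma expR_int (a : R) (k : int) : expR (k%:~R * a) = expR a ^ k.
Proof.
case: k => m; first by rewrite -pmulrn expRM_natl.
by rewrite NegzE mulrNz mulNr expRN -pmulrn expRM_natl exprnN.
Qed.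

Lemma normr_exprz (F : numFieldType) (x : F) (k : int) : `|x ^ k| = `|x| ^ k.
Proof.
case: k => m; first by rewrite -!exprnP normrX.
by rewrite NegzE -!exprnN normfV normrX.
Qed.

(** Dirichlet's bound on the rank of the unit group: the logarithms of the
    absolute values of a unit sum to zero, so $n$ units are linearly dependent
    over the reals; rounding the multiples of a real relation produces
    infinitely many integral exponents whose products stay bounded, hence
    coincide. *)
Lemma units_relation (w : 'I_n -> L) : (forall i, UL (w i)) ->
  exists k : 'I_n -> int, (exists i, k i != 0) /\ \prod_i w i ^ k i = 1.
Proof.
move=> Uw; have w0 i : w i != 0 by case: (Uw i).
pose A : 'M[R]_n := \matrix_(i, j) ln (nrm j (w i)).
have expA i j : expR (A i j) = nrm j (w i) by rewrite mxE lnK // posrE nrm_gt0.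
have rowA i : \sum_j A i j = 0.
  apply: expR_inj; rewrite expR_sum expR0; apply: (@complexI R).
  rewrite rmorph1 -(unit_prod_norm (Uw i)) rmorph_prod.
  by apply: eq_bigr => j _; rewrite expA.
have : \det A^T == 0.
  apply/det0P; exists (const_mx 1).
    apply/eqP => /matrixP/(_ 0 (Ordinal n_gt0)); rewrite !mxE => /eqP.
    by rewrite oner_eq0.
  apply/matrixP => r i; rewrite !mxE -[RHS](rowA i).
  by apply: eq_bigr => j _; rewrite !mxE mul1r.
rewrite det_tr => /det0P[c0 c0n0 c0A].
have [i0 c0i] : exists i, c0 0 i != 0.
  apply/existsP; apply: contraNT c0n0; rewrite negb_exists => /forallP c00.
  by apply/eqP/rowP => i; have := c00 i; rewrite negbK mxE => /eqP.
pose c i := c0 0 i / c0 0 i0.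
have cA j : \sum_i c i * A i j = 0.
  transitivity ((c0 *m A) 0 j / c0 0 i0); last by rewrite c0A mxE mul0r.
  by rewrite mxE mulr_suml; apply: eq_bigr => i _; rewrite mulrAC.
pose k (t : nat) i := Num.floor (t%:R * c i).
(* Normalizing one coefficient to 1 keeps the exponents distinct. *)
have k_i0 t : k t i0 = t.
  by rewrite /k /c divff // mulr1 -[t%:R]/(t%:~R) intrKfloor.
pose x t := \prod_i w i ^ k t i.
have Ux t : UL (x t) := units_prod (k t) Uw.
have nrmX j t : nrm j (x t) = expR (\sum_i (k t i)%:~R * A i j).
  rewrite expR_sum; apply: (@complexI R).
  rewrite -[_%:C%C]/(`|phi j (x t)|) rmorph_prod normr_prod rmorph_prod.
  by apply: eq_bigr => i _; rewrite expR_int expA !fmorphXz normr_exprz.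
have [||s [t [lt_st Est]]] := @bounded_integers_repeat x
    (\sum_j expR (\sum_i `|A i j|))%:C%C.
- by move=> t; case: (Ux t).
- move=> t j; rewrite -[`|_|]/((nrm j (x t))%:C%C) lecR nrmX.
  rewrite [leRHS](bigD1 j) //= ler_wpDr ?sumr_ge0 // => [i _|].
    exact: expR_ge0.
  have -> : \sum_i (k t i)%:~R * A i j
      = \sum_i ((k t i)%:~R - t%:R * c i) * A i j.
    transitivity (\sum_i (k t i)%:~R * A i j - t%:R * \sum_i c i * A i j).
      by rewrite cA mulr0 subr0.
    by rewrite mulr_sumr -sumrB; apply: eq_bigr => i _; rewrite mulrBl mulrA.
  rewrite ler_expR; apply: ler_sum => i _; rewrite (le_trans (ler_norm _)) //.
  rewrite normrM ler_piMl // distrC ger0_norm.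
    have /andP[_] := floor_itv (t%:R * c i).
    by rewrite intrD -/(k t i) lerBlDl => /ltW.
  by rewrite subr_ge0; have /andP[] := floor_itv (t%:R * c i).
exists (fun i => k t i - k s i); split.
  by exists i0; rewrite !k_i0; lia.
have xs0 : x s != 0 by case: (Ux s).
apply: (mulfI xs0); rewrite mulr1 [in RHS]Est -big_split.
by apply: eq_bigr => i _ /=; rewrite -expfzDr // addrC subrK.
Qed.

(** Halving the exponents of a relation with even exponents gives a product
    whose square is one, and positivity at one embedding excludes minus one. *)
Lemma units_odd_relation (w : 'I_n -> L) j :
  (forall i, UL (w i)) -> (forall i, 0 < phi j (w i)) ->
  exists k : 'I_n -> int, (exists i, ~~ (2 %| k i)%Z) /\ \prod_i w i ^ k i = 1.
Proof.
move=> Uw w_pos; have [k [[i0 ki0] kw]] := units_relation Uw.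
have [N] := ubnP (`|k i0|)%N.
elim: N => // N IH in k ki0 kw *; rewrite ltnS => leN.
have [[i odd_i]|all_even] := pselect (exists i, ~~ (2 %| k i)%Z).
  by exists k; split=> //; exists i.
have even_k i : k i = (k i %/ 2)%Z * 2.
  by rewrite divzK //; apply/negPn/negP => odd_i; apply: all_even; exists i.
pose y := \prod_i w i ^ (k i %/ 2)%Z.
have y2 : y ^+ 2 = 1.
  rewrite -[RHS]kw /y -prodrXl; apply: eq_bigr => i _.
  by rewrite [in RHS]even_k -exprz_exp.
have y_pos : 0 < phi j y.
  rewrite rmorph_prod prodr_gt0 // => i _; rewrite fmorphXz.
  exact: exprz_gt0.
apply: (IH (fun i => (k i %/ 2)%Z)).
- by apply: contraNneq ki0 => E; rewrite even_k E.
- move/eqP: y2; rewrite sqrf_eq1 => /orP[/eqP //|/eqP yN1].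
  by move: y_pos; rewrite yN1 rmorphN1 oppr_gt0 ltr10.
- by have := even_k i0; move: ki0 leN => /=; lia.
Qed.

End Dirichlet.

(** * Totally positive units are norms *)

Lemma exprz_odd_lt0 (F : numFieldType) (x : F) (k : int) :
  x < 0 -> ~~ (2 %| k)%Z -> x ^ k < 0.
Proof.
move=> x_lt0 k_odd; have -> : k = 2 * (k %/ 2)%Z + 1 by lia.
rewrite expfzDr ?ltr0_neq0 // -exprz_exp expr1z pmulr_rlt0 // exprz_gt0 //.
by rewrite -exprnP -sqrrN exprn_gt0 // oppr_gt0.
Qed.

Section QuadraticExtension.
Variables (R : realType) (L : fieldExtType rat) (L0 : {subfield L}).
Local Notation C := R[i].
Local Notation UL := (@units L).

Lemma units_subvs (v : subvs_of L0) : units v <-> UL (vsval v).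
Proof.
have intE (x : subvs_of L0) : ring_of_integers x <-> ring_of_integers (vsval x).
  have eqi : (vsval : subvs_of L0 -> L) \o intr =1 (intr : int -> L).
    by move=> z /=; rewrite rmorph_int.
  by split=> -[p p_mon px]; exists p => //; move: px;
    rewrite -(eq_map_poly eqi) map_poly_comp fmorph_root.
rewrite /units /= -fmorphV.
by split=> -[v0 /intE Ov /intE Ov']; split=> //; move: v0; rewrite fmorph_eq0.
Qed.

Hypothesis dimL : \dim {:L} = (\dim L0 + \dim L0)%N.

Lemma quadratic_generation a x : a \notin L0 ->
  exists2 p : {poly L}, p \is a polyOver L0 & x = p.[a].
Proof.
move=> aL0; suff Lfull : <<L0; a>>%VS = fullv.
  by apply/Fadjoin_polyP; rewrite Lfull memvf.
apply/eqP; rewrite eqEdim subvf /= dimL dim_Fadjoin addnn -mul2n.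
rewrite leq_mul2r; apply/orP; right.
by rewrite ltn_neqAle eq_sym adjoin_deg_eq1 aL0.
Qed.

Variable f : {rmorphism L -> C}.
Hypothesis f_real : forall x, x \in L0 -> f x \is Num.real.

Lemma real_in_subfield a : (exists x, f x \isn't Num.real) ->
  f a \is Num.real -> a \in L0.
Proof.
move=> [x fx] fa; apply: contraNT fx => aL0.
have [p /polyOverP p_L0 ->] := quadratic_generation x aL0.
rewrite -horner_map horner_coef rpred_sum // => i _.
by rewrite coef_map rpredM //= ?rpredX // f_real.
Qed.

(** A second embedding that agrees on the subfield sends a generator to one of
    the two roots of the same real quadratic polynomial. *)
Lemma quadratic_extension_embeddings (g : {rmorphism L -> C}) a b :
  a \notin L0 -> f b = (f a)^* -> g b = (g a)^* ->
  (forall x, x \in L0 -> f x = g x) -> a + b \in L0 -> a * b \in L0 ->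
  (forall x, g x = f x) \/ (forall x, g x = (f x)^*).
Proof.
move=> aL0 fb gb fg sL0 pL0.
have root_ga : (g a - f a) * (g a - (f a)^*) = 0.
  have Es := fg _ sL0; have Ep := fg _ pL0; rewrite !rmorphD !rmorphM in Es Ep.
  rewrite -fb; transitivity (g a ^+ 2 - g a * (f a + f b) + f a * f b).
    by ring.
  by rewrite Es Ep; ring.
have ext (g' : {rmorphism L -> C}) : (forall x, x \in L0 -> f x = g' x) ->
    g' a = f a -> forall x, g' x = f x.
  move=> fg' ga x; have [p /polyOverP p_L0 ->] := quadratic_generation x aL0.
  rewrite -!horner_map !horner_coef ga /=.
  rewrite !size_map_poly; apply: eq_bigr => i _; rewrite !coef_map /=.
  by rewrite -fg'.
move/eqP: root_ga; rewrite mulf_eq0 !subr_eq0 => /orP[]/eqP ga.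
  by left; exact: ext.
right=> x; have := ext (Num.conj \o g : {rmorphism L -> C}) _ _ x => /= <-.
- by rewrite conjCK.
- by move=> y yL0; rewrite /= -fg // (conj_Creal (f_real yL0)).
- by rewrite /= ga conjCK.
Qed.

End QuadraticExtension.

Lemma unit_outside_index2 (L : fieldExtType rat) (H : set L) :
  (forall x, H x -> units x) -> index_eq (@units L) H 2 ->
  exists2 v, units v & ~ H v.
Proof.
move=> HU idx; apply/not_exists2P => UH.
have HE : H = @units L.
  apply/seteqP; split=> // x Ux; apply: contrapT => nHx.
  by have [] := UH x.
move: idx; rewrite /index_eq HE.
have -> : ([set [set u * h | h in @units L] | u in @units L] =
    [set @units L])%classic.
  apply/seteqP; split=> [_ [u Uu <-]|_ ->] /=.
    apply/seteqP; split=> [_ [h Uh <-]|x Ux] /=; first exact: unitsM.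
    exists (u^-1 * x); first by apply: unitsM => //; exact: unitsV.
    by rewrite mulVKf //; case: Uu.
  exists 1; first exact: units1.
  apply/seteqP; split=> [_ [h Uh <-]|x Ux]; first by rewrite mul1r.
  by exists x; rewrite ?mul1r.
by rewrite (card_eql card_set1) => /card_eq_II.
Qed.

Section PositiveUnits.
Variables (R : realType) (L : fieldExtType rat) (L0 : {subfield L}) (n : nat).
Variable phi : 'I_n -> {rmorphism L -> R[i]}.
Local Notation C := R[i].
Local Notation OL := (@ring_of_integers L).
Local Notation UL := (@units L).

Hypothesis n_gt0 : (0 < n)%N.
Hypotheses (dimL0 : \dim L0 = n) (dimL : \dim {:L} = (n + n)%N).
Hypothesis phi_real : forall i x, x \in L0 -> phi i x \is Num.real.
Hypothesis phi_imag : forall i, exists x, phi i x \isn't Num.real.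
Hypothesis phi_inj : injective phi.
Hypothesis phi_conj : forall i j, ~ (forall x, phi j x = (phi i x)^*).
Variable B : 'M[C]_(n, n + n).
Hypothesis cmB : CM_lattice phi B.

Let dimLL0 : \dim {:L} = (\dim L0 + \dim L0)%N.
Proof. by rewrite dimL0. Qed.

Variable h : 'I_n -> C.
Hypothesis h_gt0 : forall i, 0 < h i.
Hypothesis h_dual : self_dual B h.

Let h_neq0 i : h i != 0 := lt0r_neq0 (h_gt0 i).

(** The adjoint of multiplication by an integer with respect to a diagonal
    form is its complex conjugate, and self-duality makes it preserve the
    lattice. *)
Lemma conj_integer a : OL a ->
  exists2 a', OL a' & forall i, phi i a' = (phi i a)^*.
Proof.
move=> Oa; have st_a := integers_stabilize cmB Oa.
have /(cm_multiplier cmB)[a' Oa' a'E] :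
    stabilizes B (map_mx Num.conj (cm_mx phi a)).
  move=> x Bx; apply/h_dual => y By; have := (h_dual x).1 Bx _ (st_a y By).
  congr (complex.Im _ \is a Num.int); apply: eq_bigr => i _.
  rewrite cm_mxE map_diag_mx mul_diag_mx !mxE rmorphM /=.
  ring.
exists a' => // i; move/matrixP/(_ i i): a'E.
by rewrite !mxE eqxx /= !mulr1n.
Qed.

Lemma conj_unit u : UL u ->
  exists u', [/\ UL u', forall i, phi i u' = (phi i u)^* & u * u' \in L0].
Proof.
move=> [u0 Ou Ou']; have [v Ov vE] := conj_integer Ou.
have [w Ow wE] := conj_integer Ou'.
have vw : v^-1 = w.
  apply: (fmorph_inj (phi (Ordinal n_gt0))).
  by rewrite fmorphV vE wE !fmorphV.
have v0 : v != 0.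
  by rewrite -(fmorph_eq0 (phi (Ordinal n_gt0))) vE conjC_eq0 fmorph_eq0.
exists v; split=> //; first by split; rewrite ?vw.
apply: (real_in_subfield dimLL0 (phi_real (Ordinal n_gt0)) (phi_imag _)).
by rewrite rmorphM vE -normCK rpredX // normr_real.
Qed.

Lemma phi_subfield_inj i j : (forall x, x \in L0 -> phi i x = phi j x) -> i = j.
Proof.
move=> Eij; have [a0 a0_im] := phi_imag i.
have [m m_gt0 Oa] := cm_integral_multiple n_gt0 a0 cmB.
set a := a0 *+ m in Oa; have [b Ob bE] := conj_integer Oa.
have aL0 : a \notin L0.
  apply: contraNN a0_im => /(phi_real i).
  by rewrite /a !CrealE !rmorphMn /= eqr_pMn2r.
have real_in := real_in_subfield dimLL0 (phi_real i) (phi_imag i).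
have sL0 : a + b \in L0.
  by apply: real_in; rewrite rmorphD bE CrealE rmorphD /= conjCK addrC.
have pL0 : a * b \in L0.
  by apply: real_in; rewrite rmorphM bE -normCK rpredX // normr_real.
have [E|E] := quadratic_extension_embeddings dimLL0 (phi_real i) aL0
    (bE i) (bE j) Eij sL0 pL0.
  by apply: phi_inj; apply: rmorphism_ext => x; rewrite E.
by case: (phi_conj E).
Qed.

Hypothesis signs : almost_independent_signs R (subvs_of L0).

Lemma real_embedding i : exists s : {rmorphism subvs_of L0 -> R},
  forall x, (s x)%:C%C = phi i (vsval x).
Proof.
pose s (x : subvs_of L0) : R := complex.Re (phi i (vsval x)).
have sE x : (s x)%:C%C = phi i (vsval x).
  by rewrite RRe_real // phi_real // subvsP.
have s_zmod : zmod_morphism s.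
  by move=> x y; apply: (@complexI R); rewrite rmorphB /= !sE !rmorphB.
have s_monoid : monoid_morphism s.
  split; first by apply: (@complexI R); rewrite sE !rmorph1.
  by move=> x y; apply: (@complexI R); rewrite rmorphM /= !sE !rmorphM.
pose sM : {rmorphism subvs_of L0 -> R} := HB.pack s
  (GRing.isZmodMorphism.Build _ _ s s_zmod)
  (GRing.isMonoidMorphism.Build _ _ s s_monoid).
by exists sM => x; rewrite -sE.
Qed.

Lemma sign_unit i j : i != j -> exists e, [/\ UL e, e \in L0
  & forall l, phi l e < 0 <-> l = i \/ l = j].
Proof.
move=> nij; have /boolp.choice[s sE] := real_embedding.
have s_inj k l : s k = s l -> k = l.
  move=> Es; apply: phi_subfield_inj => x xL0.
  by rewrite -[x](vsprojK xL0) -!sE Es.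
have [e Ue eE] : exists2 u : subvs_of L0, units u &
    [set r : {rmorphism subvs_of L0 -> R} | r u < 0]%classic
      = [set s i; s j]%classic.
  by apply: signs.2 => /s_inj ij; rewrite ij eqxx in nij.
exists (vsval e); split; [by apply/units_subvs | exact: subvsP |].
move=> l; rewrite -sE -(rmorph0 (real_complex R)) ltcR.
have : (s l e < 0) <-> [set s i; s j]%classic (s l) by rewrite -eE.
move=> ->; split=> [[/s_inj|/s_inj] ->|[->|->]]; by [left | right].
Qed.

(** Kronecker's theorem: the powers of $z$ stay bounded, so two of them are
    equal. *)
Lemma kronecker z : OL z -> (forall i, `|phi i z| = 1) -> roots_of_unity z.
Proof.
move=> Oz z1; have [||s [t [lt_st Est]]] :=
    bounded_integers_repeat n_gt0 dimL cmB (x := fun t => z ^+ t) (K := 1).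
- elim=> [|t IH]; first exact: (ring_of_integers_int L 1).
  by rewrite exprS; exact: integral_mul.
- by move=> t i; rewrite rmorphXn normrX z1 expr1n.
have z0 : z != 0.
  by rewrite -(fmorph_eq0 (phi (Ordinal n_gt0))) -normr_eq0 z1 oner_neq0.
exists (t - s)%N; first by rewrite subn_gt0.
apply: (mulfI (expf_neq0 s z0)); rewrite mulr1 -exprD subnKC //.
exact: ltnW.
Qed.

Definition unit_square (x : L) : Prop :=
  exists y, [/\ UL y, y \in L0 & x = y ^+ 2].

Definition unit_norm (x : L) : Prop :=
  exists2 v, UL v & forall i, phi i x = `|phi i v| ^+ 2.

Lemma unit_squareM x y : unit_square x -> unit_square y -> unit_square (x * y).
Proof.
move=> [a [Ua aL0 ->]] [b [Ub bL0 ->]]; exists (a * b).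
by rewrite exprMn; split; [exact: unitsM | exact: rpredM | ].
Qed.

Lemma unit_squareV x : unit_square x -> unit_square x^-1.
Proof.
move=> [a [Ua aL0 ->]]; exists a^-1.
by rewrite exprVn; split; [exact: unitsV | rewrite rpredV | ].
Qed.

Lemma unit_square1 : unit_square 1.
Proof.
by exists 1; rewrite expr1n; split; [exact: units1 | exact: rpred1 |].
Qed.

Lemma unit_square_even x (k : int) : UL x -> x \in L0 -> (2 %| k)%Z ->
  unit_square (x ^ k).
Proof.
move=> Ux xL0 k2; exists (x ^ (k %/ 2)%Z); split; first exact: unitsX.
  by case: (k %/ 2)%Z => m; rewrite ?NegzE -?exprnN -?exprnP ?rpredV rpredX.
by rewrite -{1}(divzK k2) -exprz_exp.
Qed.

Lemma unit_normM x y : unit_norm x -> unit_norm y -> unit_norm (x * y).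
Proof.
move=> [a Ua aE] [b Ub bE]; exists (a * b) => [|i]; first exact: unitsM.
by rewrite !rmorphM aE bE normrM exprMn.
Qed.

Lemma unit_normV x : unit_norm x -> unit_norm x^-1.
Proof.
move=> [a Ua aE]; exists a^-1 => [|i]; first exact: unitsV.
by rewrite !fmorphV aE normfV exprVn.
Qed.

Lemma unit_normX x (k : int) : unit_norm x -> unit_norm (x ^ k).
Proof.
move=> [a Ua aE]; exists (a ^ k) => [|i]; first exact: unitsX.
by rewrite !fmorphXz aE normr_exprz !exprnP !exprz_exp mulrC.
Qed.

Lemma unit_square_norm x : unit_square x -> unit_norm x.
Proof.
move=> [y [Uy yL0 ->]]; exists y => // i.
by rewrite rmorphXn /= real_normK // phi_real.
Qed.

(** An odd power of $x$ differs from $x$ by an even power, which is the square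
    of a unit of $L_0$. *)
Lemma odd_power_root (G : L -> Prop) x (k : int) :
  (forall y z, G y -> G z -> G (y * z)) -> (forall y, unit_square y -> G y) ->
  UL x -> x \in L0 -> ~~ (2 %| k)%Z -> G (x ^ k) -> G x.
Proof.
move=> GM Gsq Ux xL0 k_odd Gxk.
have x0 : x != 0 by case: Ux.
have -> : x = x ^ k * x ^ (1 - k) by rewrite -expfzDr // addrC subrK expr1z.
by apply: GM => //; apply/Gsq/unit_square_even => //; lia.
Qed.

Hypothesis unit_index : hasse_unit_index_eq L0 2.

(** The norm of a unit $v$ outside $\mu_L \mathcal{U}_{L_0}$. If it were the
    square of a unit $w$ of $L_0$, then $v / w$ would be a root of unity by
    Kronecker's theorem. *)
Lemma nonsquare_norm : exists eps,
  [/\ UL eps, eps \in L0, unit_norm eps & ~ unit_square eps].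
Proof.
have [|v Uv nHv] := unit_outside_index2 _ unit_index.
  move=> _ [z [m m_gt0 zm] [v Uv <-]]; apply: unitsM; last exact/units_subvs.
  have z0 : z != 0.
    apply: contra_eq_neq zm => ->.
    by rewrite expr0n (gtn_eqF m_gt0) eq_sym oner_neq0.
  have root1_int y : y ^+ m = 1 -> OL y.
    move=> ym; exists ('X^m - 1); first by rewrite monicXnsubC.
    by rewrite rmorphB /= map_polyXn rmorph1 rootE !hornerE ym subrr.
  by split=> //; apply: root1_int; rewrite ?exprVn zm ?invr1.
have [v' [Uv' v'E pL0]] := conj_unit Uv.
have normE i : phi i (v * v') = `|phi i v| ^+ 2 by rewrite rmorphM v'E normCK.
exists (v * v'); split=> //; [exact: unitsM | by exists v |].
move=> [w [Uw wL0 wE]]; apply: nHv.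
have w0 : w != 0 by case: Uw.
exists (v / w).
  apply: kronecker => [|i].
    by have [] := unitsM Uv (unitsV Uw).
  apply/eqP; rewrite -(@pexpr_eq1 _ _ 2) // rmorphM fmorphV normrM normfV.
  rewrite exprMn exprVn -normE wE rmorphXn /= real_normK ?phi_real // divff //.
  by rewrite expf_neq0 // fmorph_eq0.
exists (vsproj L0 w); last by rewrite vsprojK // divfK.
by apply/units_subvs; rewrite vsprojK.
Qed.

(** The two indices coincide only for $n = 1$, where no sign has to be
    prescribed. *)
Lemma two_indices : exists a b : 'I_n, a = b -> forall i, i = a.
Proof.
case: (n) n_gt0 => // -[|m] _; first by exists 0, 0 => _ i; rewrite ord1.
by exists 0, 1 => /eqP.
Qed.

(** Dirichlet's bound leaves room for only two classes of totally positive
    units modulo squares. Fix two embeddings $a$ and $b$. The $n - 2$ units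
    negative exactly at $b$ and at one further embedding, the nonsquare norm
    and the given unit satisfy a multiplicative relation with an odd exponent.
    Reading signs at the further embeddings makes the exponents of the first
    $n - 2$ units even, and the nonsquare norm cannot carry the only odd
    exponent. *)
Lemma totally_positive_unit_norm u : UL u -> u \in L0 ->
  (forall i, 0 < phi i u) -> unit_norm u.
Proof.
move=> Uu uL0 u_pos; have [eps [Ueps epsL0 eps_norm eps_nsq]] := nonsquare_norm.
have [a [b ab]] := two_indices.
have eps_pos i : 0 < phi i eps.
  have [v [v0 _ _] ->] := eps_norm.
  by rewrite exprn_gt0 // normr_gt0 fmorph_eq0.
have /boolp.choice[w wP] i : exists x, [/\ UL x, x \in L0 &
    (if i == a then x = u else if i == b then x = eps
     else forall l, phi l x < 0 <-> l = i \/ l = b)].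
  case: (eqVneq i a) => [_|_]; first by exists u.
  case: (eqVneq i b) => [_|nib]; first by exists eps.
  by have [e [Ue eL0 eE]] := sign_unit nib; exists e.
have Uw i : UL (w i) by case: (wP i).
have wL0 i : w i \in L0 by case: (wP i).
have w0 i : w i != 0 by case: (Uw i).
have w_pos i j : ~ phi i (w j) < 0 -> 0 < phi i (w j).
  have := phi_real i (wL0 j); rewrite realE => /orP[ge0 _|le0 nlt0].
    by rewrite lt_def ge0 fmorph_eq0 w0.
  by case: nlt0; rewrite lt_neqAle le0 fmorph_eq0 w0.
have wa_pos i : 0 < phi a (w i).
  have [_ _] := wP i; case: eqVneq => [_ -> //|nia].
  case: eqVneq => [_ -> //|_ wE]; apply: w_pos => /wE[ai|/ab a_all].
    by rewrite ai eqxx in nia.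
  by rewrite (a_all i) eqxx in nia.
have [k [[i0 odd_i0] kw]] := units_odd_relation n_gt0 dimL cmB Uw wa_pos.
have even_k i : i != a -> i != b -> (2 %| k i)%Z.
  move=> nia nib; apply/negPn/negP => odd_i.
  have : 0 < phi i (\prod_j w j ^ k j) by rewrite kw rmorph1.
  have wi_neg : phi i (w i) < 0.
    by have [_ _] := wP i; rewrite (negPf nia) (negPf nib) => ->; left.
  rewrite rmorph_prod (bigD1 i) //= pmulr_lgt0; last first.
    apply: prodr_gt0 => j nji; rewrite fmorphXz exprz_gt0 // w_pos //.
    have [_ _] := wP j; case: eqVneq => [_ ->|_].
      by move=> /lt_gtF; rewrite u_pos.
    case: eqVneq => [_ ->|_ ->]; first by move=> /lt_gtF; rewrite eps_pos.
    by case=> [ij|ib]; [rewrite ij eqxx in nji | rewrite ib eqxx in nib].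
  by rewrite fmorphXz (lt_gtF (exprz_odd_lt0 wi_neg odd_i)).
have w_inv i : w i ^ k i = (\prod_(j | j != i) w j ^ k j)^-1.
  have prod0 : \prod_(j | j != i) w j ^ k j != 0.
    by apply/prodf_neq0 => j _; rewrite expfz_neq0.
  by apply: (mulIf prod0); rewrite mulVf // -[RHS]kw [in RHS](bigD1 i).
have even_square i : (2 %| k i)%Z -> unit_square (w i ^ k i).
  by move=> k2; exact: unit_square_even.
have [ka_odd|/negbNE ka_even] := boolP (~~ (2 %| k a)%Z).
  have wa : w a = u by have [_ _] := wP a; rewrite eqxx.
  apply: (odd_power_root (k := k a)) => //.
  - exact: unit_normM.
  - exact: unit_square_norm.
  rewrite -wa w_inv; apply: unit_normV; elim/big_ind: _ => [||j nja].
  - exact/unit_square_norm/unit_square1.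
  - exact: unit_normM.
  - have [jb|njb] := eqVneq j b; last exact/unit_square_norm/even_square/even_k.
    have [_ _] := wP j; rewrite (negPf nja) jb eqxx => ->.
    exact: unit_normX.
have nba : b != a.
  apply/eqP => ba; case/negP: odd_i0.
  by rewrite (ab (esym ba) i0).
have nia0 : i0 != a by apply: contraNneq odd_i0 => ->.
have i0b : i0 = b by apply/eqP; apply: contraNT odd_i0; exact: even_k.
rewrite i0b in odd_i0.
have wb : w b = eps by have [_ _] := wP b; rewrite (negPf nba) eqxx.
case: eps_nsq; apply: (odd_power_root (k := k b)) => //.
  exact: unit_squareM.
rewrite -wb w_inv; apply: unit_squareV; elim/big_ind: _ => [||j njb].
- exact: unit_square1.
- exact: unit_squareM.
- by apply: even_square; have [->|nja] := eqVneq j a; last exact: even_k.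
Qed.

(** The ratio of the two forms stabilizes the lattice, and so does its inverse:
    it is a unit, totally positive and hence in $L_0$. *)
Lemma self_dual_forms_equivalent (h' : 'I_n -> C) :
  (forall i, 0 < h' i) -> self_dual B h' ->
  exists2 v, UL v & forall i, h' i * `|phi i v| ^+ 2 = h i.
Proof.
move=> h'_gt0 h'_dual.
have ratio (g g' : 'I_n -> C) : (forall i, g i != 0) -> self_dual B g ->
    self_dual B g' -> exists2 a, OL a & forall i, phi i a = g' i / g i.
  move=> g0 g_dual g'_dual; pose T := diag_mx (\row_i (g' i / g i)) : 'M[C]_n.
  have /(cm_multiplier cmB)[a Oa aE] : stabilizes B T.
    move=> x Bx; apply/g_dual => y By; have := (g'_dual x).1 Bx _ By.
    congr (complex.Im _ \is a Num.int); apply: eq_bigr => i _.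
    by rewrite mul_diag_mx !mxE mulrA [g i * _]mulrC divfK.
  exists a => // i; move/matrixP/(_ i i): aE.
  by rewrite !mxE eqxx /= !mulr1n => ->.
have h'_neq0 i : h' i != 0 := lt0r_neq0 (h'_gt0 i).
have [u Ou uE] := ratio h' h h'_neq0 h'_dual h_dual.
have [u' Ou' u'E] := ratio h h' h_neq0 h_dual h'_dual.
have u_pos i : 0 < phi i u by rewrite uE divr_gt0.
have u'V : u^-1 = u'.
  apply: (fmorph_inj (phi (Ordinal n_gt0))).
  by rewrite fmorphV uE u'E invf_div.
have Uu : UL u.
  split=> //; last by rewrite u'V.
  by rewrite -(fmorph_eq0 (phi (Ordinal n_gt0))) lt0r_neq0.
have uL0 : u \in L0.
  apply: (real_in_subfield dimLL0 (phi_real (Ordinal n_gt0)) (phi_imag _)).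
  by rewrite gtr0_real.
have [v Uv vE] := totally_positive_unit_norm Uu uL0 u_pos.
by exists v => // i; rewrite -vE uE mulrC divfK.
Qed.

End PositiveUnits.

(** * Lattices as fractional ideals *)

Section LatticeIdeal.
Variables (R : realType) (L : fieldExtType rat) (n : nat).
Variable phi : 'I_n -> {rmorphism L -> R[i]}.
Local Notation C := R[i].
Local Notation OL := (@ring_of_integers L).
Hypotheses (n_gt0 : (0 < n)%N) (dimL : \dim {:L} = (n + n)%N).

Let j0 : 'I_(n + n) := lshift n (Ordinal n_gt0).

(** The lattice read off in $L$ from its first basis vector, on whose orbit
    under $L$ the whole lattice lies. *)
Definition lattice_ideal (B : 'M[C]_(n, n + n)) : set L :=
  [set a | int_span B (cm_mx phi a *m col j0 B)]%classic.

Section OneLattice.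
Variable B : 'M[C]_(n, n + n).
Hypothesis cmB : CM_lattice phi B.

Lemma base_coord_neq0 i : B i j0 != 0.
Proof. exact: (cm_orbit_coord_neq0 (cm_free cmB) dimL (cm_rational cmB)). Qed.

Lemma cm_base_inj a b :
  cm_mx phi a *m col j0 B = cm_mx phi b *m col j0 B -> a = b.
Proof.
move=> /matrixP/(_ (Ordinal n_gt0) 0); rewrite !cm_mxE mxE.
by move=> /(mulIf (base_coord_neq0 _)) /fmorph_inj.
Qed.

Lemma lattice_idealP z : int_span B z ->
  exists2 a, lattice_ideal B a & z = cm_mx phi a *m col j0 B.
Proof.
move=> Bz; have /int_spanP[k zE] := Bz.
have [a aE] := cm_orbit (cm_free cmB) dimL (cm_rational cmB) j0 (map_mx intr k).
have {}aE : z = cm_mx phi a *m col j0 B.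
  rewrite aE zE -map_mx_comp; congr (_ *m _).
  by apply: eq_map_mx => c /=; rewrite ratr_int.
by exists a => //; rewrite /lattice_ideal /= -aE.
Qed.

Lemma ring_of_integers_sum (I : finType) (F : I -> L) :
  (forall i, OL (F i)) -> OL (\sum_i F i).
Proof.
move=> OF; elim/big_ind: _ => [|x y Ox Oy|i _]; last exact: OF.
- exact: (ring_of_integers_int L 0).
- exact: integral_add.
Qed.

Lemma lattice_ideal_fractional : fractional_ideal (lattice_ideal B).
Proof.
split.
- exists 1; rewrite ?oner_neq0 // /lattice_ideal /= cm_mx1 mul1mx.
  exact: int_span_col.
- move=> x y Ix Iy; rewrite /lattice_ideal /= cm_mxD mulmxDl.
  exact: int_spanD.
- move=> a x Oa Ix; rewrite /lattice_ideal /= cm_mxM -mulmxA.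
  exact: (integers_stabilize cmB Oa).
have /boolp.choice[g gE] :=
  cm_orbit_col (cm_free cmB) dimL (cm_rational cmB) j0.
have /boolp.choice[m mE] j : exists m : nat, (0 < m)%N /\ OL (g j *+ m).
  by have [m] := cm_integral_multiple n_gt0 (g j) cmB; exists m.
exists (\prod_j m j)%:R; split.
- rewrite -(fmorph_eq0 (phi (Ordinal n_gt0))) rmorph_nat pnatr_eq0 -lt0n.
  by rewrite prodn_gt0 // => j; case: (mE j).
- exact: (ring_of_integers_int L (\prod_j m j)%N).
move=> x /int_spanP[k xE].
have -> : x = \sum_j g j *~ k j 0.
  apply: cm_base_inj; rewrite xE; apply/matrixP => i l; rewrite ord1 cm_mxE.
  rewrite rmorph_sum /= mulr_suml mxE; apply: eq_bigr => j _.
  move/matrixP/(_ i 0): (gE j); rewrite cm_mxE => gji.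
  by rewrite -mulrzr rmorphM rmorph_int mulrAC gji !mxE.
rewrite mulr_sumr; apply: ring_of_integers_sum => j.
have [_ Om] := mE j; rewrite (bigD1 j) //= natrM.
set M := (\prod_(l < n + n | l != j) m l)%N.
have -> : (m j)%:R * M%:R * (g j *~ k j 0) = g j *+ m j * M%:R * (k j 0)%:~R.
  by rewrite -mulr_natr -mulrzr; ring.
apply: integral_mul; last exact: ring_of_integers_int.
by apply: integral_mul => //; exact: (ring_of_integers_int L M).
Qed.

End OneLattice.

(** When the two ideals differ by the factor $x$, the diagonal matrix that sends
    the base point of one lattice, multiplied by $x$, to the base point of the
    other is an isomorphism. *)
Lemma class_number1_lattices (B1 B2 : 'M[C]_(n, n + n)) : class_number_eq L 1 ->
  CM_lattice phi B1 -> CM_lattice phi B2 ->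
  exists2 t : 'I_n -> C, (forall i, t i != 0) &
    forall z, int_span B1 z <-> int_span B2 (diag_mx (\row_i t i) *m z).
Proof.
move=> cl1 cm1 cm2.
have cl_eq : ideal_class (lattice_ideal B1) = ideal_class (lattice_ideal B2).
  have /card_set_bijP[f [f_fun f_inj _]] := cl1.
  have in_cl B : CM_lattice phi B ->
      [set ideal_class I | I in @fractional_ideal L]%classic
        (ideal_class (lattice_ideal B)).
    move=> cmB; exists (lattice_ideal B) => //.
    exact: lattice_ideal_fractional.
  apply: f_inj; rewrite ?inE; try exact: in_cl.
  have := f_fun _ (in_cl _ cm1); have := f_fun _ (in_cl _ cm2).
  by rewrite /= !ltnS !leqn0 => /eqP -> /eqP ->.
have [x x0 I12] : ideal_class (lattice_ideal B2) (lattice_ideal B1).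
  rewrite -cl_eq; exists 1; first exact: oner_neq0.
  apply/seteqP; split=> [y Iy|_ [y Iy <-]] /=; last by rewrite mul1r.
  by exists y; rewrite ?mul1r.
pose t i := B2 i j0 / (phi i x * B1 i j0).
have den0 i : phi i x * B1 i j0 != 0.
  by rewrite mulf_neq0 ?fmorph_eq0 // base_coord_neq0.
have t0 i : t i != 0 by rewrite mulf_neq0 ?invr_eq0 // base_coord_neq0.
have tE y : diag_mx (\row_i t i) *m (cm_mx phi (x * y) *m col j0 B1) =
    cm_mx phi y *m col j0 B2.
  apply/matrixP => i l; rewrite ord1 mul_diag_mx cm_mxE mxE cm_mxE !mxE.
  have := den0 i; rewrite mulf_eq0 negb_or rmorphM /t => /andP[xi0 Bi0].
  by field; rewrite xi0 Bi0.
exists t => // z; split=> [/(lattice_idealP cm1)[a]|].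
  by rewrite I12 => -[y I2y <-] ->; rewrite tE.
move=> /(lattice_idealP cm2)[y I2y tz].
have I1xy : lattice_ideal B1 (x * y) by rewrite I12; exists y.
have -> : z = cm_mx phi (x * y) *m col j0 B1; last exact: I1xy.
apply/matrixP => i l; apply: (mulfI (t0 i)).
move: tz; rewrite -tE => /matrixP/(_ i l).
by rewrite !mul_diag_mx !mxE.
Qed.

End LatticeIdeal.

(** * Principally polarized CM abelian varieties *)

Section Uniqueness.
Variables (R : realType) (L : fieldExtType rat) (L0 : {subfield L}).
Variable Phi : set {rmorphism L -> R[i]}.
Local Notation C := R[i].
Local Notation n := (\dim L0).
Hypothesis hL : CM_field R L.
Hypothesis hL0 : maximal_totally_real_subfield R L0.

Lemma totally_real_subfield (f : {rmorphism L -> C}) x :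
  x \in L0 -> f x \is Num.real.
Proof.
move=> xL0.
have := hL0.1 (f \o vsval : {rmorphism subvs_of L0 -> C}) (vsproj L0 x).
by rewrite /= vsprojK.
Qed.

(** The subfield over which $L$ is quadratic is contained in $L_0$, and $L_0$ is
    not $L$ because $L$ has an imaginary embedding. *)
Lemma CM_field_dim : (exists f : {rmorphism L -> C}, True) ->
  \dim {:L} = (n + n)%N.
Proof.
move=> [f _]; have [ti [K K_real K2]] := hL.
have KL0 : (K <= L0)%VS := hL0.2 K K_real.
have dimK : \dim {:L} = (2 * \dim K)%N.
  by rewrite -K2 divnK // field_dimS ?subvf.
have L0_proper : (\dim L0 < \dim {:L})%N.
  rewrite ltn_neqAle dimvS ?subvf // andbT; apply/negP => /eqP dimE.
  have L0_full : L0 = fullv :> {vspace L}.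
    by apply/eqP; rewrite eqEdim subvf /= dimE.
  have [x] := ti f; rewrite totally_real_subfield // L0_full.
  exact: memvf.
have /dvdnP[c cE] : (\dim L0 %| \dim {:L})%N by rewrite field_dimS ?subvf.
have K_le : (\dim K <= \dim L0)%N := dimvS KL0.
have : (1 < c)%N by nia.
have : (0 < \dim L0)%N := adim_gt0 _.
nia.
Qed.

Hypothesis signs : almost_independent_signs R (subvs_of L0).
Hypothesis unit_index : hasse_unit_index_eq L0 2.
Hypothesis CM_Phi : CM_type Phi.

Section Isomorphism.
Variable phi : 'I_n -> {rmorphism L -> C}.
Hypothesis phiP : set_bij [set: 'I_n]%classic Phi phi.

Let n_gt0 : (0 < n)%N := adim_gt0 L0.
Let dimL : \dim {:L} = (n + n)%N.
Proof. by apply: CM_field_dim; exists (phi (Ordinal n_gt0)). Qed.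

Lemma CM_type_inj : injective phi.
Proof.
by move=> i j E; case: phiP => _ phi_inj _; apply: phi_inj; rewrite ?inE.
Qed.

Lemma CM_type_conj i j : ~ (forall x, phi j x = (phi i x)^*).
Proof. by case: phiP => phi_fun _ _; apply: CM_Phi.2; exact: phi_fun. Qed.

(** Pulling the second polarization back along the scaling gives two self-dual
    forms on the first lattice; the unit $v$ by which they differ corrects the
    scaling to an isometry. *)
Lemma polarized_isomorphic_of_scaling (A1 A2 : abelian_variety R n)
    (P1 P2 : 'M[C]_n) (B1 B2 : 'M[C]_(n, n + n)) (t : 'I_n -> C)
    (H1 H2 : {dot 'cV[C]_n for Num.conj}) :
  P1 \in unitmx -> CM_lattice phi B1 ->
  (forall x, lattice A1 x <-> int_span B1 (P1 *m x)) ->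
  P2 \in unitmx -> CM_lattice phi B2 ->
  (forall x, lattice A2 x <-> int_span B2 (P2 *m x)) ->
  (forall i, t i != 0) ->
  (forall z, int_span B1 z <-> int_span B2 (diag_mx (\row_i t i) *m z)) ->
  principal_polarization A1 H1 -> principal_polarization A2 H2 ->
  polarized_isomorphic A1 H1 A2 H2.
Proof.
move=> P1u cm1 lat1 P2u cm2 lat2 t0 B12 pp1 pp2; set T := diag_mx _ in B12.
have [h1 [h1_gt0 h1_dual H1E]] :=
  principal_polarization_diagonal CM_type_inj P1u cm1 lat1 pp1.
have [h2 [h2_gt0 h2_dual H2E]] :=
  principal_polarization_diagonal CM_type_inj P2u cm2 lat2 pp2.
pose T' : 'M[C]_n := diag_mx (\row_i (t i)^-1).
have TT' : T *m T' = 1%:M.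
  rewrite mul_diag_mx; apply/matrixP => i j; rewrite !mxE mulrnAr divff //.
pose h i := h2 i * `|t i| ^+ 2.
have formT x y : diag_form h2 (T *m x) (T *m y) = diag_form h x y.
  apply: eq_bigr => i _; rewrite !mul_diag_mx !mxE rmorphM /h normCK /=; ring.
have h_gt0 i : 0 < h i by rewrite mulr_gt0 // exprn_gt0 // normr_gt0.
have h_dual : self_dual B1 h.
  move=> x; rewrite B12 h2_dual; split=> xd y By.
    by rewrite -formT; apply/xd/B12.
  rewrite -[y]mul1mx -TT' -mulmxA formT; apply/xd/B12.
  by rewrite mulmxA TT' mul1mx.
have [v Uv vE] := self_dual_forms_equivalent n_gt0 erefl dimL
  (fun i => @totally_real_subfield (phi i)) (fun i => hL.1 (phi i))
  CM_type_inj CM_type_conj cm1 h1_gt0 h1_dual signs unit_index h_gt0 h_dual.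
have [v0 Ov Ov'] := Uv.
have cm_vV : cm_mx phi v *m cm_mx phi v^-1 = 1%:M.
  by rewrite -cm_mxM divff // cm_mx1.
exists (invmx P2 *m T *m cm_mx phi v *m P1); split.
- have [Tu _] := mulmx1_unit TT'; have [vu _] := mulmx1_unit cm_vV.
  by rewrite !unitmx_mul unitmx_inv P2u Tu vu P1u.
- apply/seteqP; split=> [_ [x /lat1 Bx <-]|y /lat2 By] /=.
    apply/lat2; rewrite -!mulmxA mulKVmx //; apply/B12.
    exact: (integers_stabilize cm1 Ov).
  exists (invmx P1 *m (cm_mx phi v^-1 *m (T' *m (P2 *m y)))).
    apply/lat1; rewrite mulKVmx //; apply: (integers_stabilize cm1 Ov').
    by apply/B12; rewrite mulmxA TT' mul1mx.
  rewrite -!mulmxA mulKVmx // [cm_mx phi v *m _]mulmxA cm_vV mul1mx.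
  by rewrite [T *m _]mulmxA TT' mul1mx mulKmx.
move=> x y; rewrite H2E H1E -!mulmxA !mulKVmx // formT.
apply: eq_bigr => i _; rewrite !cm_mxE rmorphM /= -vE normCK; ring.
Qed.

End Isomorphism.

Lemma CM_abelian_variety_ordering (g : nat) (A : abelian_variety R g) :
  CM_abelian_variety Phi A ->
  exists phi : 'I_g -> {rmorphism L -> C}, set_bij [set: 'I_g]%classic Phi phi.
Proof. by move=> [[iota [_ [phi [P [phiP _ _]]]]] _]; exists phi. Qed.

End Uniqueness.

Theorem proposition4p5 (R : realType) (L : fieldExtType rat)
    (L0 : {subfield L}) (Phi : set {rmorphism L -> R[i]})
    (hL : CM_field R L)
    (hL0 : maximal_totally_real_subfield R L0)
    (hsigns : almost_independent_signs R (subvs_of L0))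
    (hQ : hasse_unit_index_eq L0 2)
    (hPhi : simple_CM_type Phi) :
  (forall A : abelian_variety R (\dim L0), CM_abelian_variety Phi A ->
     forall H1 H2 : {dot 'cV[R[i]]_(\dim L0) for Num.conj},
       principal_polarization A H1 -> principal_polarization A H2 ->
       polarized_isomorphic A H1 A H2) /\
  (class_number_eq L 1 ->
     forall (A1 A2 : abelian_variety R (\dim L0))
            (H1 H2 : {dot 'cV[R[i]]_(\dim L0) for Num.conj}),
       CM_abelian_variety Phi A1 -> principal_polarization A1 H1 ->
       CM_abelian_variety Phi A2 -> principal_polarization A2 H2 ->
       polarized_isomorphic A1 H1 A2 H2).
Proof.
have CM_Phi := hPhi.1; have n_gt0 : (0 < \dim L0)%N := adim_gt0 L0.
split=> [A cmA H1 H2 pp1 pp2|cl1 A1 A2 H1 H2 cmA1 pp1 cmA2 pp2].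
  have [phi phiP] := CM_abelian_variety_ordering cmA.
  have dimL := CM_field_dim hL hL0 (ex_intro _ (phi (Ordinal n_gt0)) I).
  have [P [B [Pu cmB latB]]] := CM_abelian_variety_lattice n_gt0 dimL phiP cmA.
  apply: (polarized_isomorphic_of_scaling hL hL0 hsigns hQ CM_Phi phiP
    Pu cmB latB Pu cmB latB (t := fun=> 1)) => // [i|z]; first exact: oner_neq0.
  have -> : diag_mx (\row__ 1) = 1%:M :> 'M[R[i]]_(\dim L0).
    by apply/matrixP => i j; rewrite !mxE.
  by rewrite mul1mx.
have [phi phiP] := CM_abelian_variety_ordering cmA1.
have dimL := CM_field_dim hL hL0 (ex_intro _ (phi (Ordinal n_gt0)) I).
have [P1 [B1 [P1u cm1 lat1]]] :=
  CM_abelian_variety_lattice n_gt0 dimL phiP cmA1.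
have [P2 [B2 [P2u cm2 lat2]]] :=
  CM_abelian_variety_lattice n_gt0 dimL phiP cmA2.
have [t t0 B12] := class_number1_lattices n_gt0 dimL cl1 cm1 cm2.
exact: (polarized_isomorphic_of_scaling hL hL0 hsigns hQ CM_Phi phiP
  P1u cm1 lat1 P2u cm2 lat2 t0 B12).
Qed.
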